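(* Let $G_0=(V,E)$ be a finite simple graph, and let $F$ and $Z_0$ be edge-disjoint spanning subgraphs of $G_0$ with $\delta(Z_0)>\Delta(F)$, such that $|E(Z_0)|\geq |V|-1$ when $\delta(G_0)=1$. Then there is a simple graph $G$ on the vertex set $V$ with $\deg_G(v)=\deg_{G_0}(v)$ for every $v\in V$ and $E(G_0)\setminus E(Z_0)\subseteq E(G)$ (that is, $G\in\mathcal{R}(G_0,G_0-E(Z_0))$) such that $G-E(F)$ is maximally edge-connected, i.e. $\lambda(G-E(F))=\delta(G-E(F))$.
   Context: All graphs are finite and simple. For a graph $G$, $\deg_G(v)$ is the degree of $v$, $\delta(G)$ and $\Delta(G)$ are the minimum and maximum degrees, and $\lambda(G)$ is the edge-connectivity. $G$ is maximally edge-connected if $\lambda(G)=\delta(G)$. A spanning subgraph of $G_0$ has vertex set $V$ (its edge set may be empty). For a set $M$ of edges, $G-M$ is the graph on the same vertex set with the edges of $M$ removed. $\mathcal{R}(G_0,F')$, for a graph $F'$ with vertex set $V$, denotes the set of all simple graphs $G$ on $V$ with $\deg_G(v)=\deg_{G_0}(v)$ for all $v\in V$ and $E(F')\subseteq E(G)$. *)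

(* Defs.v *)
From mathcomp Require Import all_boot.

Set Implicit Arguments.
Unset Strict Implicit.
Unset Printing Implicit Defensive.

Record sgraph (V : finType) := SGraph {
  adj :> rel V;
  adj_sym : symmetric adj;
  adj_irrefl : irreflexive adj
}.

Section Graphs.

Variable V : finType.
Implicit Types (G H : sgraph V) (M : {set {set V}}).

Definition edges G : {set {set V}} :=
  [set [set p.1; p.2] | p : V * V & adj G p.1 p.2].

Definition spanning_subgraph H G : bool := edges H \subset edges G.

Definition edge_disjoint G H : bool := [disjoint edges G & edges H].

Definition deg G (v : V) : nat := #|[set w | adj G v w]|.

(* Every degree is less than #|V|, so the default value #|V| only matters when
   V is empty. *)
Definition min_deg G : nat := \big[minn/#|V|]_(v : V) deg G v.

Definition max_deg G : nat := \max_(v : V) deg G v.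

Definition del_adj G M : rel V := fun x y => adj G x y && ([set x; y] \notin M).

Lemma del_adj_sym G M : symmetric (del_adj G M).
Proof. by move=> x y; rewrite /del_adj adj_sym setUC. Qed.

Lemma del_adj_irrefl G M : irreflexive (del_adj G M).
Proof. by move=> x; rewrite /del_adj adj_irrefl. Qed.

Definition del_edges G M : sgraph V :=
  SGraph (@del_adj_sym G M) (@del_adj_irrefl G M).

Definition connected G : bool := [forall x, forall y, connect (adj G) x y].

(* When V has at least two vertices, M = edges G is itself a disconnecting set,
   so the default value does not affect the minimum; when V has at most one
   vertex no set disconnects G, and the value is #|edges G| = 0. *)
Definition edge_connectivity G : nat :=
  \big[minn/#|edges G|]_(M : {set {set V}} |
     (M \subset edges G) && ~~ connected (del_edges G M)) #|M|.

Definition maximally_edge_connected G : Prop :=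
  edge_connectivity G = min_deg G.

Lemma in_edges G x y : ([set x; y] \in edges G) = adj G x y.
Proof.
apply/imsetP/idP => [[[a b]] | Gxy]; last by exists (x, y); rewrite ?inE.
rewrite inE /= => Gab exy.
have: a \in [set x; y] by rewrite exy set21.
have: b \in [set x; y] by rewrite exy set22.
have: x \in [set a; b] by rewrite -exy set21.
have: y \in [set a; b] by rewrite -exy set22.
rewrite !in_set2.
have nab : a != b by apply: contraTneq Gab => ->; rewrite adj_irrefl.
case/orP=> /eqP ey; case/orP=> /eqP ex; subst x y => //.
- by rewrite orbb eq_sym (negPf nab).
- by move=> _; rewrite adj_sym.
- by move=> _; rewrite orbb (negPf nab).
Qed.

End Graphs.

(* Main.v *)
Require Import Defs.
From mathcomp Require Import all_boot.
From mathcomp Require Import zify.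

Set Implicit Arguments.
Unset Strict Implicit.
Unset Printing Implicit Defensive.

(** Fix every edge of [G0] outside [Z0] and write [h] for the edges of a
    realization outside [F], [z] for its edges that may be moved, and [cut T] for
    the number of [h]-edges leaving [T].  The degrees of [h] and [z] are the same
    in all realizations; let [delta] be the least degree of [h] and [f] the
    greatest degree of [F], so that all degrees of [z] exceed [f].  By induction on
    [k <= delta] there is a realization in which every proper cut has at least [k]
    edges.  If [k < delta] and some cuts are tight (have exactly [k] edges), an
    exchange of two movable edges [u u'], [v v'] for [u v'], [u' v] destroys a
    tight cut and creates none ([improve], [raise_cuts]).

    Such an exchange is sought between two disjoint inclusion-minimal tight sets
    [X] and [Y] (atoms), with [u u'] inside [X] and [v v'] inside [Y].  An atom has
    more than [delta > k] vertices, hence vertices without neighbours outside it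
    (its interior).  From interior vertices [u] and [v], the new edges are never in
    [h], and since [z]-degrees exceed [F]-degrees they can be kept out of [F].  Only
    a set [S] that contains [u] and [v'] but neither [u'] nor [v], or the complement
    of such a set, loses edges, and it loses two.  Submodularity gives
    [cut S >= k + 2] ([cross_half]); the exchange fails only if [cut S = k + 2],
    and then [S] is rigid ([cross_barrier]): all edges leaving [S] lie inside [X] or
    inside [Y], and [S] halves both atoms, each part of an atom receiving half of the
    [k] edges that leave the atom and having a cut of exactly [k + 1] edges.  Suppose
    first that [delta > 1] and that every exchange is blocked in this way; the first
    two of the following regimes lead to a contradiction.  The third one provides an
    exchange directly.

    - [k + 1 < delta].  A smallest part [P] of a halving of [X] has more than
      [delta] vertices and only [k + 1] leaving edges, so some vertex [u] has all
      its neighbours in [P].  By uncrossing no halving of [X] separates two vertices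
      of [P], so no barrier separates [u] from [u'] ([stuck_deficient]).

    - [k + 1 = delta >= 2].  Two barriers cannot cut [X] in parallel and [Y] crosswise
      ([barrier_twist]).  So of the two ways to reconnect the ends of [u u'] and
      [v v'] one is not blocked, and there must be an [F]-edge between [u u'] and
      [v v'] ([stuck_F_edge]); this ends the case [f = 0].  If [f > 0], each atom
      contains a part [K] with about [k] vertices that no halving separates
      ([core_exists]).  A [z]-edge [u w] inside [K] with [u] interior forces [w] to
      be [F]-adjacent to the whole interior of [Y], which bounds that interior by
      [f] ([card_interior_le]).  Counting the edges that leave [K] then excludes
      everything except [k = 2] and [f <= 2] with [K] of size two, where
      [stuck_matching] (for [f = 1]) and again [barrier_twist] (for [f = 2]) apply.

    - [delta = 1].  Then [F] has no edges and [k = 0].  The bound on the number of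
      edges of [Z0] says that [z] is not a forest with at least two components, so
      some [z]-edge lies in no cut of size one; exchanging it with any [z]-edge of
      the other side of a tight cut merges two components ([improving_low]). *)

Definition nbh (V : finType) (g : rel V) (x : V) : {set V} := [set y | g x y].

(** * Counting the edges of a forest *)

Section Forest.

Variables (V : finType) (z : rel V).
Hypotheses (z_sym : symmetric z) (z_irr : irreflexive z).

(** Each edge is represented once, by its orientation along the enumeration. *)
Definition arcs : {set V * V} :=
  [set e | z e.1 e.2 && (enum_rank e.1 < enum_rank e.2)].

Lemma sum_nbh : \sum_x #|nbh z x| = 2 * #|arcs|.
Proof.
pose r x y : nat := z x y && (enum_rank x < enum_rank y).
have -> : #|arcs| = \sum_x \sum_y r x y.
  rewrite pair_bigA -sum1_card big_mkcond; apply: eq_bigr => e _.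
  by rewrite inE /r; case: andb.
rewrite mul2n -addnn {2}exchange_big -big_split; apply: eq_bigr => x _.
rewrite -big_split -sum1_card big_mkcond; apply: eq_bigr => y _.
rewrite inE /r [z y x]z_sym /=; case zxy: (z x y) => //=.
case: ltngtP => // /val_inj/enum_rank_inj exy.
by rewrite exy z_irr in zxy.
Qed.

(** If every edge [e] is a bridge, it is the only edge crossing some set [side e].
    Over the field with two elements the indicators of the sets [side e] are then
    independent, and they stay so together with those of [T] and of the whole set,
    because no edge separates [T].  The count compares the combinations, encoded by
    a set of edges and two booleans, with the subsets of [V]. *)
Lemma card_forest T :
  T != set0 -> T != setT -> (forall x y, z x y -> (x \in T) = (y \in T)) ->
  (forall x y, z x y -> exists S : {set V}, [/\ x \in S, y \notin S &
     forall a b, z a b -> a \in S -> b \notin S -> (a, b) = (x, y)]) ->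
  #|arcs| + 2 <= #|V|.
Proof.
move=> T0 TT zT bridge.
pose sole (e : V * V) (S : {set V}) := [&& e.1 \in S, e.2 \notin S &
  [forall a, forall b, [&& z a b, a \in S & b \notin S] ==> ((a, b) == e)]].
pose side e := odflt set0 [pick S | sole e S].
have sideP e : e \in arcs -> sole e (side e).
  rewrite inE /side => /andP[ze _]; case: pickP => [//|no].
  have [S [xS yS eS]] := bridge _ _ ze; have := no S; rewrite /sole xS yS /=.
  move/negP; case; apply/forallP => a; apply/forallP => b; apply/implyP.
  by case/and3P=> zab aS bS; rewrite (eS _ _ zab aS bS) -surjective_pairing.
have sideE e x y : e \in arcs -> (x, y) \in arcs ->
    (x \in side e) (+) (y \in side e) = (e == (x, y)).
  move=> eE xyE; have /and3P[e1 e2 /forallP uniqe] := sideP e eE.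
  have [ee|ne] := eqVneq e (x, y).
    by rewrite ee /= in e1 e2 *; rewrite e1 (negPf e2).
  move: xyE; rewrite inE /= => /andP[zxy rxy].
  case xS: (x \in side e); case yS: (y \in side e) => //=.
    have := forallP (uniqe x) y.
    by rewrite zxy xS yS eq_sym (negPf ne).
  have := forallP (uniqe y) x; rewrite z_sym zxy xS yS /= => /eqP ee.
  by move: eE; rewrite -ee inE /= => /andP[_]; rewrite ltnNge ltnW.
pose phi (d : {set V * V} * (bool * bool)) : {set V} :=
  [set x | \big[addb/false]_(e in d.1) (x \in side e) (+) (d.2.1 && (x \in T))
           (+) d.2.2].
have phi_inj : {in setX (powerset arcs) setT &, injective phi}.
  case=> [c1 [a1 b1]] [c2 [a2 b2]]; rewrite !inE !andbT => /subsetP s1 /subsetP s2 eq.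
  (* the coefficient of an edge is read off by comparing its two ends *)
  have memc (c : {set V * V}) a b x y : {subset c <= arcs} -> (x, y) \in arcs ->
      (x \in phi (c, (a, b))) (+) (y \in phi (c, (a, b))) = ((x, y) \in c).
    move=> sc xyE; rewrite !inE /=.
    have /zT -> : z x y by move: xyE; rewrite inE => /andP[].
    transitivity (\big[addb/false]_(e in c) ((x \in side e) (+) (y \in side e))).
      rewrite big_split /=; case: (\big[addb/false]_(e in c) (x \in side e));
      by case: (\big[addb/false]_(e in c) (y \in side e)); case: (_ && _); case: b.
    rewrite (eq_bigr (fun e => e == (x, y))); last by by move=> e /sc eE; apply: sideE.
    have [xyc|xyc] := boolP ((x, y) \in c).
      by rewrite (bigD1 _ xyc) eqxx big1 //= => e /andP[_ /negPf].
    by apply: big1 => e ec; apply: contraNF xyc => /eqP <-.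
  have ec : c1 = c2.
    apply/setP => -[x y]; have [xyE|xyE] := boolP ((x, y) \in arcs).
      by rewrite -(memc _ a1 b1 _ _ s1 xyE) eq memc.
    by apply/idP/idP => [/s1|/s2]; rewrite (negPf xyE).
  have [t tT] := set0Pn _ T0; have [t' t'T] : exists t', t' \notin T.
    have : ~~ (setT \subset T) by rewrite subTset.
    by case/subsetPn => t' _; exists t'.
  suff [-> ->] : a1 = a2 /\ b1 = b2 by rewrite ec.
  move/setP: eq => eq; have := eq t; have := eq t'; rewrite !inE /= -ec tT (negPf t'T).
  clear s1 s2 memc eq.
  case: (\big[addb/false]_(e in c1) (t \in side e));
  case: (\big[addb/false]_(e in c1) (t' \in side e));
  by case: a1; case: a2; case: b1; case: b2.
have := max_card (mem (phi @: setX (powerset arcs) setT)).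
rewrite card_in_imset // cardsX card_powerset cardsT card_prod card_bool.
rewrite -[#|{set V}|]cardsT -powersetT card_powerset cardsT -(expnD 2 _ 2).
by rewrite leq_exp2l.
Qed.

End Forest.

(** * Cuts and their submodularity *)

Section Cuts.

Variables (V : finType) (h : rel V).
Hypothesis h_sym : symmetric h.
Implicit Types (x y u v w p q : V) (A B C S T X Y P Q K D : {set V}).

Definition ecount A B : nat := \sum_x \sum_y [&& x \in A, y \in B & h x y].

Definition cut T := ecount T (~: T).

Lemma ecount_nbh A B : ecount A B = \sum_(x in A) #|nbh h x :&: B|.
Proof.
rewrite [RHS]big_mkcond; apply: eq_bigr => x _; case: (x \in A) => /=; last first.
  by rewrite big1.
rewrite -sum1_card [RHS]big_mkcond; apply: eq_bigr => y _.
by rewrite !inE andbC; case: andb.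
Qed.

Lemma ecount1 x B : ecount [set x] B = #|nbh h x :&: B|.
Proof. by rewrite ecount_nbh big_set1. Qed.

Lemma ecountC A B : ecount A B = ecount B A.
Proof.
rewrite /ecount exchange_big; apply: eq_bigr => x _; apply: eq_bigr => y _.
by rewrite h_sym; case: (x \in _); case: (y \in _).
Qed.

Lemma leq_ecount A A' B B' :
  A \subset A' -> B \subset B' -> ecount A B <= ecount A' B'.
Proof.
move=> /subsetP sA /subsetP sB; apply: leq_sum => x _; apply: leq_sum => y _.
case: (boolP (x \in A)) => //= /sA ->; case: (boolP (y \in B)) => //= /sB ->.
by [].
Qed.

Lemma ecount_eq0 A B x y :
  ecount A B = 0 -> x \in A -> y \in B -> h x y = false.
Proof.
move=> e0 xA yB; apply/negbTE/negP => hxy; move: e0.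
rewrite /ecount (bigD1 x) //= (bigD1 y) //= xA yB hxy; lia.
Qed.

Lemma ecount_gt0 A B x y : x \in A -> y \in B -> h x y -> 0 < ecount A B.
Proof.
move=> xA yB hxy; rewrite lt0n; apply/eqP => e0.
by rewrite (ecount_eq0 e0 xA yB) in hxy.
Qed.

Lemma ecountIDl A B C : ecount A B = ecount (A :&: C) B + ecount (A :\: C) B.
Proof.
rewrite /ecount -big_split; apply: eq_bigr => x _.
rewrite -big_split; apply: eq_bigr => y _ /=; rewrite !inE.
by case: (x \in A); case: (x \in C); case: (y \in B); case: (h x y).
Qed.

Lemma ecountIDr A B C : ecount A B = ecount A (B :&: C) + ecount A (B :\: C).
Proof. by rewrite ecountC (ecountIDl _ _ C) ![ecount _ A]ecountC. Qed.

Lemma cutC T : cut (~: T) = cut T.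
Proof. by rewrite /cut setCK ecountC. Qed.

(** The exact form of submodularity: the defect counts the edges between the two
    differences. *)
Lemma cut_modular A B :
  cut A + cut B = cut (A :&: B) + cut (A :|: B) + 2 * ecount (A :\: B) (B :\: A).
Proof.
rewrite mul2n -addnn {2}[ecount (A :\: B) _]ecountC addnA /cut /ecount.
rewrite -!big_split; apply: eq_bigr => x _.
rewrite -!big_split; apply: eq_bigr => y _ /=; rewrite !inE.
by case: (x \in A); case: (x \in B); case: (y \in A); case: (y \in B); case: (h x y).
Qed.

Lemma cut_posimodular A B :
  cut A + cut B =
  cut (A :\: B) + cut (B :\: A) + 2 * ecount (A :&: B) (~: (A :|: B)).
Proof.
rewrite -(cutC B) cut_modular -setDE; congr (_ + _ + 2 * _).
  by rewrite -cutC setCU setCK setIC setDE.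
by rewrite setDE setCK setDE -setCU setUC.
Qed.

Lemma cut_sub P X : P \subset X -> cut P = ecount P (X :\: P) + ecount P (~: X).
Proof.
move=> sPX; rewrite /cut (ecountIDr _ _ X); congr (ecount _ _ + ecount _ _).
  by rewrite setDE setIC.
by rewrite setDE -setCU; congr (~: _); apply/setUidPr.
Qed.

Lemma cut0 : cut set0 = 0.
Proof. by rewrite /cut ecount_nbh big_set0. Qed.

Lemma cut_gt0 T x y : x \in T -> y \notin T -> h x y -> 0 < cut T.
Proof. by move=> xT yT; apply: ecount_gt0 => //; rewrite inE. Qed.

Lemma cut_eq0 T x y : cut T = 0 -> h x y -> (x \in T) = (y \in T).
Proof.
move=> c0 hxy; apply/idP/idP => [xT|yT]; apply: contraT => nT.
  by move: (cut_gt0 xT nT hxy); rewrite c0.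
by rewrite h_sym in hxy; move: (cut_gt0 yT nT hxy); rewrite c0.
Qed.

(** * Atoms, halvings and barriers *)

Section Tight.

Variable k : nat.
Hypothesis cut_ge : forall T, T != set0 -> T != setT -> k <= cut T.

Definition tight T := [&& T != set0, T != setT & cut T == k].

Definition atom X := minset tight X.

Lemma tightC T : tight T -> tight (~: T).
Proof.
case/and3P=> T0 TT cT; rewrite /tight cutC cT andbT; apply/andP; split.
  by apply: contra TT => /eqP eT; rewrite -(setCK T) eT setC0.
by apply: contra T0 => /eqP eT; rewrite -(setCK T) eT setCT.
Qed.

Lemma atom_tight X : atom X -> tight X.
Proof. by move=> /minsetp. Qed.

Lemma atom_cut X : atom X -> cut X = k.
Proof. by move/atom_tight/and3P=> [_ _ /eqP]. Qed.

Lemma atom_sub X P : atom X -> P \subset X -> P != set0 -> P != X -> k < cut P.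
Proof.
move=> aX sPX P0 PX; have PT : P != setT.
  by apply: contra PX => /eqP eP; rewrite eqEsubset sPX eP subsetT.
rewrite ltn_neqAle cut_ge // andbT; apply: contra PX => ck.
have /minsetP[_ mX] := aX; apply/eqP/mX => //.
by rewrite /tight P0 PT eq_sym ck.
Qed.

(** The only way an atom can be cut when an exchange is blocked: both parts have the
    least cut that minimality of the atom allows; as the empty set has cut 0, both
    are nonempty. *)
Definition halving X P :=
  [&& P \subset X, cut P == k.+1 & cut (X :\: P) == k.+1].

Lemma halvingD X P : halving X P -> halving X (X :\: P).
Proof.
case/and3P=> sPX cP cXP; apply/and3P; split; rewrite ?subsetDl //.
by rewrite setDDr setDv set0U (setIidPr sPX).
Qed.

Lemma halving_neq0 X P : halving X P -> P != set0.
Proof. by case/and3P=> _ cP _; apply: contraTneq cP => ->; rewrite cut0. Qed.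

Lemma halving_neq X P : halving X P -> P != X.
Proof.
by case/and3P=> _ _ cP; apply: contraTneq cP => ->; rewrite setDv cut0.
Qed.

(** The two parts have equal cuts and share the edges between them, so they also
    share evenly the [k] edges leaving [X]. *)
Lemma halving_out X P :
  atom X -> halving X P ->
  2 * ecount P (~: X) = k /\ 2 * ecount P (X :\: P) = k + 2.
Proof.
move=> /atom_cut cX /and3P[sPX /eqP cP /eqP cQ].
have := cut_sub sPX; have := cut_sub (subsetDl X P); rewrite cP cQ.
have -> : X :\: (X :\: P) = P by rewrite setDDr setDv set0U (setIidPr sPX).
rewrite [ecount (X :\: P) P]ecountC.
have := ecountIDl X (~: X) P; rewrite (setIidPr sPX) -[ecount X _]/(cut X) cX.
lia.
Qed.

(** Uncrossing: submodularity for [P], [Q] and for their complements in [X], where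
    all four intersections and unions have cuts above [k]. *)
Lemma halvingI X P Q :
  atom X -> halving X P -> halving X Q -> P :&: Q != set0 -> P :|: Q != X ->
  halving X (P :&: Q).
Proof.
move=> aX hP hQ I0 UX.
have /and3P[sP /eqP cP /eqP cP'] := hP; have /and3P[sQ /eqP cQ /eqP cQ'] := hQ.
have P0 := halving_neq0 hP; have PX := halving_neq hP.
have sU : P :|: Q \subset X by rewrite subUset sP.
have sI : P :&: Q \subset X by rewrite subIset ?sP.
have IX : P :&: Q != X.
  by apply: contra PX => /eqP eI; rewrite eqEsubset sP -eI subsetIl.
have U0 : P :|: Q != set0.
  by apply: contra P0 => /eqP eU; rewrite -subset0 -eU subsetUl.
have dN0 A : A \subset X -> A != X -> X :\: A != set0.
  by move=> sA; apply: contra; rewrite setD_eq0 eqEsubset sA.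
have dNX A : A \subset X -> A != set0 -> X :\: A != X.
  move=> sA; apply: contra => /eqP/setDidPl; rewrite disjoint_sym => dA.
  by rewrite -(setIidPl sA) setI_eq0.
have := atom_sub aX sI I0 IX.
have := atom_sub aX sU U0 UX.
have := atom_sub aX (subsetDl X _) (dN0 _ sI IX) (dNX _ sI I0).
have := atom_sub aX (subsetDl X _) (dN0 _ sU UX) (dNX _ sU U0).
have := cut_modular P Q; have := cut_modular (X :\: P) (X :\: Q).
rewrite -setDUr -setDIr cP cQ cP' cQ' => m1 m2 l1 l2 l3 l4.
rewrite /halving; suff [-> ->] : cut (P :&: Q) = k.+1 /\ cut (X :\: (P :&: Q)) = k.+1.
  by rewrite sI !eqxx.
by clear - m1 m2 l1 l2 l3 l4; lia.
Qed.

(** The rigid shape of a set that blocks an exchange between the atoms [X] and [Y]. *)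
Record barrier X Y S : Prop := Barrier {
  barrier_l : halving X (X :&: S);
  barrier_r : halving Y (Y :&: S);
  barrier_edge : forall x y, h x y -> (x \in S) != (y \in S) ->
    (x \in X) && (y \in X) || (x \in Y) && (y \in Y) }.

Lemma barrier_sym X Y S : barrier X Y S -> barrier Y X S.
Proof.
by case=> bl br be; split=> // x y hxy nS; rewrite orbC; apply: be.
Qed.

Lemma barrierC X Y S : barrier X Y S -> barrier X Y (~: S).
Proof.
case=> bl br be; split; rewrite -?setDE.
- by move/halvingD: bl; rewrite setDIr setDv set0U.
- by move/halvingD: br; rewrite setDIr setDv set0U.
by move=> x y hxy nS; apply: be => //; move: nS; rewrite !inE; do 2!case: (_ \in S).
Qed.


(** Crossing [X] costs one edge over [k], as a proper part of an atom is not tight,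
    and so does crossing [Y]: this is submodularity for [X], [S] followed by
    posimodularity for the union of [X] and [S] with [Y]. *)
Lemma cross_half X Y S :
  atom X -> atom Y -> [disjoint X & Y] ->
  X :&: S != set0 -> Y :\: S != set0 -> X :\: S != set0 -> Y :&: S != set0 ->
  cut S <= k + 2 ->
  [/\ cut S = k + 2, cut (X :&: S) = k.+1 & cut (Y :\: S) = k.+1].
Proof.
move=> aX aY dXY XS YnS XnS YS cS.
have IX : X :&: S != X by apply: contra XnS => /eqP/setIidPl; rewrite -setD_eq0.
have DY : Y :\: S != Y.
  by apply: contra YS => /eqP/setDidPl; rewrite -setI_eq0.
have m1 := cut_modular X S; have m2 := cut_posimodular (X :|: S) Y.
have l1 := atom_sub aX (subsetIl X S) XS IX.
have eYD : Y :\: (X :|: S) = Y :\: S.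
  rewrite setDUr; have /setDidPl -> : [disjoint Y & X] by rewrite disjoint_sym.
  by apply/setIidPr; apply: subsetDl.
have l2 := atom_sub aY (subsetDl Y S) YnS DY.
have l3 : k <= cut ((X :|: S) :\: Y).
  apply: cut_ge.
    have /set0Pn[x] := XS; rewrite inE => /andP[xX _]; apply/set0Pn; exists x.
    by rewrite !inE xX (disjointFr dXY xX).
  have /set0Pn[y] := YS; rewrite inE => /andP[yY _].
  by apply/eqP => /setP/(_ y); rewrite !inE yY.
move: m1 m2 l1 l2 l3 cS; rewrite eYD (atom_cut aX) (atom_cut aY); clear.
by split; lia.
Qed.

(** The halvings of [X] and [Y] account for [k/2 + 1] edges each, which is all that
    [S] has; no crossing edge is left outside [X] and [Y]. *)
Lemma cross_barrier X Y S :
  atom X -> atom Y -> [disjoint X & Y] ->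
  X :&: S != set0 -> X :\: S != set0 -> Y :&: S != set0 -> Y :\: S != set0 ->
  cut S <= k + 2 -> barrier X Y S.
Proof.
move=> aX aY dXY XS XnS YS YnS cS.
have dYX : [disjoint Y & X] by rewrite disjoint_sym.
have [eS cXS cYnS] := cross_half aX aY dXY XS YnS XnS YS cS.
have [_ cYS cXnS] := cross_half aY aX dYX YS XnS YnS XS cS.
have hX : halving X (X :&: S).
  by rewrite /halving subsetIl setDIr setDv set0U cXS cXnS !eqxx.
have hY : halving Y (Y :&: S).
  by rewrite /halving subsetIl setDIr setDv set0U cYS cYnS !eqxx.
have [_ i1] := halving_out aX hX; have [_ i2] := halving_out aY hY.
rewrite !setDIr !setDv !set0U in i1 i2.
have dis c : ~~ ((c \in X) && (c \in Y)).
  by apply/negP => /andP[cX]; rewrite (disjointFr dXY cX).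
have edge x y : h x y -> x \in S -> y \notin S ->
    (x \in X) && (y \in X) || (x \in Y) && (y \in Y).
  move=> hxy xS yS; apply: contraT => nXY.
  suff : ecount (X :&: S) (X :\: S) + ecount (Y :&: S) (Y :\: S) +
         ecount [set x] [set y] <= cut S.
    have := ecount_gt0 (set11 x) (set11 y) hxy.
    by move: i1 i2 eS; clear; lia.
  rewrite /cut /ecount -!big_split; apply: leq_sum => a _.
  rewrite -!big_split; apply: leq_sum => b _; rewrite !inE /=.
  case: (h a b); rewrite ?andbF ?andbT //.
  have [ax|nax] := eqVneq a x; first have [bx|nbx] := eqVneq b y.
  - rewrite ax bx xS yS /= !andbT.
    by move: nXY; case: (x \in X); case: (y \in X); case: (x \in Y); case: (y \in Y).
  - rewrite andbF addn0; move: (dis a) (dis b).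
    by case: (a \in X); case: (b \in X); case: (a \in S); case: (b \in S);
      case: (a \in Y); case: (b \in Y).
  rewrite addn0; move: (dis a) (dis b).
  by case: (a \in X); case: (b \in X); case: (a \in S); case: (b \in S);
    case: (a \in Y); case: (b \in Y).
split=> // x y hxy; case: (boolP (x \in S)) => xS; case: (boolP (y \in S)) => yS //.
  by move=> _; apply: edge.
by move=> _; rewrite andbC [(x \in Y) && _]andbC edge // h_sym.
Qed.

(** A halving part inside another has the same number of edges leaving [X], hence the
    same such edges. *)
Lemma halving_out_sub X P Q :
  atom X -> halving X P -> halving X Q -> Q \subset P ->
  forall x y, x \in P -> y \notin X -> h x y -> x \in Q.
Proof.
move=> aX hP hQ sQP x y xP yX hxy; apply: contraT => xQ.
have [oP _] := halving_out aX hP; have [oQ _] := halving_out aX hQ.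
have := ecountIDl P (~: X) Q; rewrite (setIidPr sQP).
have : 0 < ecount (P :\: Q) (~: X) by apply: ecount_gt0 hxy; rewrite !inE ?xQ.
by move: oP oQ; clear; lia.
Qed.

(** If two barriers have a common vertex [u] and a common non-vertex [w] in [X], their
    intersection still halves [X] and thus carries the outgoing edges of both. *)
Lemma barrier_parallel_out X Y S1 S2 x y u w :
  atom X -> barrier X Y S1 -> barrier X Y S2 ->
  u \in X -> u \in S1 -> u \in S2 -> w \in X -> w \notin S1 -> w \notin S2 ->
  x \in X -> y \notin X -> h x y -> (x \in S1) = (x \in S2).
Proof.
move=> aX b1 b2 uX u1 u2 wX w1 w2 xX yX hxy.
have eI : (X :&: S1) :&: (X :&: S2) = X :&: (S1 :&: S2) by rewrite setIACA setIid.
have hI : halving X (X :&: (S1 :&: S2)).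
  rewrite -eI; apply: halvingI (barrier_l b1) (barrier_l b2) _ _ => //.
    by apply/set0Pn; exists u; rewrite !inE uX u1 u2.
  by apply/eqP => /setP/(_ w); rewrite !inE wX (negPf w1) (negPf w2).
have s1 : X :&: (S1 :&: S2) \subset X :&: S1 by rewrite setIA subsetIl.
have s2 : X :&: (S1 :&: S2) \subset X :&: S2 by rewrite setICA subsetIr.
apply/idP/idP => xS.
  have := halving_out_sub aX (barrier_l b1) hI s1 (x := x) _ yX hxy.
  by rewrite !inE xX xS /=; move=> /(_ isT).
have := halving_out_sub aX (barrier_l b2) hI s2 (x := x) _ yX hxy.
by rewrite !inE xX xS /= andbT => /(_ isT).
Qed.

(** Let the barriers run in parallel in [X] and crosswise in [Y].  By
    [barrier_parallel_out], vertices of [X] with an edge leaving [X] are outside the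
    symmetric difference of [S1] and [S2], and those of [Y] with an edge leaving [Y]
    are inside it.  Adding [Y] to this difference and removing [X] then gives a
    proper set with an empty cut. *)
Lemma barrier_twist X Y S1 S2 u w a b :
  0 < k -> atom X -> atom Y -> [disjoint X & Y] ->
  barrier X Y S1 -> barrier X Y S2 ->
  u \in X -> u \in S1 -> u \in S2 -> w \in X -> w \notin S1 -> w \notin S2 ->
  a \in Y -> a \in S1 -> a \notin S2 -> b \in Y -> b \notin S1 -> b \in S2 ->
  False.
Proof.
move=> k0 aX aY dXY b1 b2 uX u1 u2 wX w1 w2 aiY a1 a2 bY nb1 b2'.
have outX x y := @barrier_parallel_out X Y S1 S2 x y u w aX b1 b2
  uX u1 u2 wX w1 w2.
have outY x y : x \in Y -> y \notin Y -> h x y -> (x \in S1) = (x \notin S2).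
  move=> xY yY hxy.
  rewrite (@barrier_parallel_out Y X S1 (~: S2) x y a b) ?inE ?b2' //.
  - exact: barrier_sym.
  - exact/barrierC/barrier_sym.
have edge S x y : barrier X Y S -> h x y ->
    ~~ ((x \in X) && (y \in X)) && ~~ ((x \in Y) && (y \in Y)) ==>
    ((x \in S) == (y \in S)).
  move=> [_ _ bS] hxy; apply/implyP; rewrite -negb_or; apply: contraR.
  exact: bS.
have out x y : h x y -> ((x \in X) && (y \notin X) ==> ((x \in S1) == (x \in S2)))
    && ((x \in Y) && (y \notin Y) ==> ((x \in S1) == (x \notin S2))).
  move=> hxy; apply/andP; split; apply/implyP => /andP[xi yo].
    exact/eqP/outX/hxy.
  exact/eqP/outY/hxy.
have dis x : ~~ ((x \in X) && (x \in Y)).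
  by apply/negP => /andP[xX]; rewrite (disjointFr dXY xX).
pose T := [set x | (x \notin X) && ((x \in Y) || ((x \in S1) != (x \in S2)))].
have T0 : T != set0.
  by apply/set0Pn; exists a; rewrite !inE aiY (disjointFl dXY aiY).
have TT : T != setT by apply/eqP => /setP/(_ u); rewrite !inE uX.
have := cut_ge T0 TT; rewrite leqNgt => /negP; apply.
suff -> : cut T = 0 by [].
rewrite /cut /ecount; apply: big1 => x _; apply: big1 => y _; apply/eqP.
rewrite eqb0 !inE; apply/negP => /and3P[xT yT hxy].
have hyx : h y x by rewrite h_sym.
move: (out _ _ hxy) (out _ _ hyx) (edge _ _ _ b1 hxy) (edge _ _ _ b2 hxy).
move: (dis x) (dis y) xT yT.
case: (x \in X); case: (x \in Y) => //=; case: (y \in X); case: (y \in Y) => //=;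
by case: (x \in S1); case: (x \in S2); case: (y \in S1); case: (y \in S2).
Qed.

(** * Vertex degrees inside atoms *)

Definition interior X := [set x in X | nbh h x \subset X].

Lemma interior_sub X : interior X \subset X.
Proof. by apply/subsetP => x; rewrite inE => /andP[]. Qed.

Lemma interior_adj X x y : x \in interior X -> h x y -> y \in X.
Proof.
by rewrite inE => /andP[_ /subsetP s] hxy; apply: s; rewrite inE.
Qed.

Lemma interior_out X x y : x \in interior X -> y \notin X -> h x y = false.
Proof. by move=> xX; apply: contraNF => /(interior_adj xX). Qed.

Lemma leq_boundary A X : A \subset X -> #|A :\: interior X| <= ecount A (~: X).
Proof.
move=> sAX; rewrite (ecountIDl _ _ (interior X)); apply: leq_trans (leq_addl _ _).
rewrite ecount_nbh -sum1_card; apply: leq_sum => x.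
rewrite !inE => /andP[xI xA]; move: xI; rewrite (subsetP sAX _ xA) /= card_gt0.
by apply: contra; rewrite -setDE setD_eq0.
Qed.

Variable delta : nat.
Hypothesis h_irr : irreflexive h.
Hypothesis delta_le : forall x, delta <= #|nbh h x|.

(** Inside [T] a vertex has at most [#|T| - 1] neighbours. *)
Lemma degree_bound T : delta * #|T| <= #|T| * #|T|.-1 + cut T.
Proof.
have : delta * #|T| <= ecount T setT.
  rewrite ecount_nbh mulnC -sum_nat_const; apply: leq_sum => x _.
  by rewrite setIT.
rewrite (ecountIDr _ _ T) setTI setTD => le; apply: leq_trans le _.
rewrite leq_add2r ecount_nbh -sum_nat_const; apply: leq_sum => x xT.
rewrite (cardsD1 x T) xT add1n /=; apply: subset_leq_card.
apply/subsetP => y; rewrite !inE => /andP[hxy ->]; rewrite andbT.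
by apply: contraTneq hxy => ->; rewrite h_irr.
Qed.

Lemma small_cut_card T : T != set0 -> cut T < delta -> delta < #|T|.
Proof.
rewrite -card_gt0; move: (degree_bound T); move: #|T| (cut T) => n c; clear.
by case: n => // n; nia.
Qed.

Lemma cut_delta_card T : 1 < #|T| -> cut T <= delta -> delta <= #|T|.
Proof.
move: (degree_bound T); move: #|T| (cut T) => n c; clear.
by case: n => // n; nia.
Qed.

Hypothesis k_delta : k < delta.

Lemma atom_card X : atom X -> delta < #|X|.
Proof.
move=> aX; apply: small_cut_card; last by rewrite atom_cut.
by have /and3P[] := atom_tight aX.
Qed.

Lemma interior_neq0 X : atom X -> exists x, x \in interior X.
Proof.
move=> aX; apply/set0Pn; apply: contraTneq (atom_card aX) => i0.
have := leq_boundary (subxx X); rewrite i0 setD0 -[ecount _ _]/(cut X) atom_cut //.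
by move: k_delta; clear; lia.
Qed.

Definition inseparable (X K : {set V}) := forall Q x y,
  halving X Q -> x \in K -> y \in K -> x \in Q -> y \in Q.

(** An inseparable part of an atom when [delta = k + 1].  A halving part of size one
    is possible there: a vertex of degree [k + 1], which must be removed from the
    smallest larger part in the second case. *)
Inductive core (X K : {set V}) : Prop :=
| CoreLarge of halving X K & k < #|K|
| CorePendant p of halving X [set p] & halving X (p |: K) & p \notin K
    & K \subset interior X & k <= #|K|.

Lemma halving1_out X x : 0 < k -> atom X -> halving X [set x] -> x \notin interior X.
Proof.
move=> k0 aX hx; have [ox _] := halving_out aX hx.
apply: contraTN k0 => xI; rewrite -ox ecount1.
suff -> : nbh h x :&: ~: X = set0 by rewrite cards0.
by apply/setP => y; rewrite !inE; apply/andP => -[/(interior_adj xI) ->].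
Qed.

Lemma halving_boundary X P : atom X -> halving X P -> 2 * #|P :\: interior X| <= k.
Proof.
move=> aX hP; have /and3P[sPX _ _] := hP; have [<- _] := halving_out aX hP.
by rewrite leq_mul2l leq_boundary.
Qed.

(** Take a smallest halving part [M] with at least two vertices; its cut has
    [delta] edges, so it has at least [delta] vertices.  By uncrossing, a halving
    that separates two vertices of [M] splits off one of them, and [{p}] itself is
    then a halving part.  As [{p}] carries all edges from [M] out of [X], there is at
    most one such [p], and the rest of [M] is interior. *)
Lemma core_exists X P :
  0 < k -> delta = k.+1 -> atom X -> halving X P ->
  exists2 K, core X K & inseparable X K.
Proof.
move=> k0 dk aX hP.
pose big Q := halving X Q && (1 < #|Q|).
have [Q0 bQ0] : exists Q, big Q.
  have [c|c] := ltnP 1 #|P|; first by exists P; rewrite /big hP.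
  exists (X :\: P); rewrite /big halvingD //=.
  have /and3P[sPX _ _] := hP.
  rewrite cardsD (setIidPr sPX); move: (atom_card aX) c k0 dk; clear; lia.
case: (arg_minnP (fun Q : {set V} => #|Q|) bQ0) => M /andP[hM M1] minM.
have /and3P[sMX /eqP cM _] := hM.
have Mk : k < #|M| by rewrite -dk cut_delta_card // cM dk.
have small Q x y : halving X Q -> x \in M -> x \in Q -> y \in M -> y \notin Q ->
    M :|: Q != X -> halving X [set x].
  move=> hQ xM xQ yM yQ UX.
  have hI : halving X (M :&: Q).
    by apply: halvingI hM hQ _ UX => //; apply/set0Pn; exists x; rewrite inE xM.
  suff <- : M :&: Q = [set x] by [].
  apply/esym/eqP; rewrite eqEcard sub1set inE xM xQ cards1 leqNgt.
  apply/negP => c; have := minM (M :&: Q); rewrite /big hI c => /(_ isT).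
  rewrite leqNgt => /negP; apply; apply: proper_card.
  by rewrite properE subsetIl; apply/subsetPn; exists y; rewrite ?inE ?negb_and ?yQ ?orbT.
have sep Q x y : halving X Q -> x \in M -> x \in Q -> y \in M -> y \notin Q ->
    halving X [set x] \/ halving X [set y].
  move=> hQ xM xQ yM yQ; have [UX|] := eqVneq (M :|: Q) X; last first.
    by move=> UX; left; apply: small hQ xM xQ yM yQ UX.
  right; apply: (small (X :\: Q) y x (halvingD hQ)) => //.
  - by rewrite inE yQ (subsetP sMX).
  - by rewrite inE xQ.
  apply: contra (halving_neq hM) => /eqP UX'; rewrite eqEsubset sMX.
  apply/subsetP => a aiX; move/setP/(_ a): UX; move/setP/(_ a): UX'.
  by rewrite !inE aiX; case: (a \in M); case: (a \in Q).
have [p /andP[pM hp]|no] := pickP [pred p in M | halving X [set p]]; last first.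
  exists M; first exact: CoreLarge.
  move=> Q x y hQ xM yM xQ; apply: contraT => yQ.
  by have := no x; have := no y; rewrite !inE xM yM /=;
    case: (sep Q x y hQ xM xQ yM yQ) => ->.
have sI : M :\ p \subset interior X.
  apply/subsetP => x; rewrite !inE => /andP[xp xM]; rewrite (subsetP sMX) //=.
  apply/subsetP => y; rewrite inE => hxy; apply: contraT => yX.
  have sp : [set p] \subset M by rewrite sub1set.
  by have := halving_out_sub aX hM hp sp xM yX hxy; rewrite inE (negPf xp).
exists (M :\ p).
  apply: (@CorePendant _ _ p) => //; rewrite ?setD1K // ?setD11 //.
  by move: (cardsD1 p M) Mk; rewrite pM; clear; lia.
move=> Q x y hQ xK yK xQ; apply: contraT => yQ.
have xM : x \in M by move: xK; rewrite inE => /andP[].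
have yM : y \in M by move: yK; rewrite inE => /andP[].
case: (sep Q x y hQ xM xQ yM yQ) => /(halving1_out k0 aX).
  by rewrite (subsetP sI).
by rewrite (subsetP sI).
Qed.

(** * Blocked exchanges *)

Section Stuck.

Variables (z F : rel V) (f : nat).
Hypothesis z_sym : symmetric z.
Hypothesis F_sym : symmetric F.
Hypothesis z_h : subrel z h.
Hypothesis degF : forall x, #|nbh F x| <= f.
Hypothesis degz : forall x, f < #|nbh z x|.
Hypothesis f_delta : f < delta.

Definition stuck (X Y : {set V}) : Prop := forall u u' v v',
  u \in X -> u' \in X -> v \in Y -> v' \in Y -> z u u' -> z v v' ->
  ~~ h u v' -> ~~ F u v' -> ~~ h u' v -> ~~ F u' v ->
  exists S, [/\ barrier X Y S, u \in S, v' \in S, u' \notin S & v \notin S].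

Lemma stuck_sym X Y : stuck X Y -> stuck Y X.
Proof.
move=> st u u' v v' uY u'Y vX v'X zu zv huv' Fuv' hu'v Fu'v.
have [||||S [b vS u'S v'S uS]] := st v v' u u' vX v'X uY u'Y zv zu.
- by rewrite h_sym.
- by rewrite F_sym.
- by rewrite h_sym.
- by rewrite F_sym.
exists (~: S); rewrite !inE uS v'S vS u'S; split=> //.
exact/barrierC/barrier_sym.
Qed.

Lemma nbh_fresh x y : exists2 x', z x x' & ~~ F y x'.
Proof.
have /subsetPn[x'] : ~~ (nbh z x \subset nbh F y).
  apply/negP => /subset_leq_card; rewrite leqNgt => /negP; apply.
  exact: leq_ltn_trans (degF y) (degz x).
by rewrite !inE; exists x'.
Qed.

Section Pair.

Variables X Y : {set V}.
Hypotheses (aX : atom X) (aY : atom Y) (dXY : [disjoint X & Y]).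
Hypothesis st : stuck X Y.

(** For interior [u] and [v] only [F] can stand in the way of the new edges. *)
Lemma interior_stuck u u' v v' :
  u \in interior X -> v \in interior Y -> z u u' -> z v v' ->
  ~~ F u v' -> ~~ F u' v ->
  exists S, [/\ barrier X Y S, u \in S, v' \in S, u' \notin S & v \notin S].
Proof.
move=> uI vI zu zv Fuv' Fu'v.
have uX := subsetP (interior_sub X) _ uI; have vY := subsetP (interior_sub Y) _ vI.
have u'X := interior_adj uI (z_h zu); have v'Y := interior_adj vI (z_h zv).
apply: st => //.
  by rewrite (interior_out uI) // (disjointFl dXY v'Y).
by rewrite h_sym (interior_out vI) // (disjointFr dXY u'X).
Qed.

(** The barrier against the first exchange has no edge between [u'] and [v'], so
    without an [F]-edge the second exchange is admissible too; its barrier meets [X]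
    in parallel and [Y] crosswise to the first. *)
Lemma stuck_F_edge u u' v v' :
  0 < k -> u \in interior X -> v \in interior Y -> z u u' -> z v v' ->
  [|| F u v, F u v', F u' v | F u' v'].
Proof.
move=> k0 uI vI zu zv; apply: contraT; rewrite !negb_or => /and4P[Fuv Fuv' Fu'v Fu'v'].
have uX := subsetP (interior_sub X) _ uI; have vY := subsetP (interior_sub Y) _ vI.
have u'X := interior_adj uI (z_h zu); have v'Y := interior_adj vI (z_h zv).
have vX := disjointFl dXY vY; have v'X := disjointFl dXY v'Y.
have u'Y := disjointFr dXY u'X.
have [S1 [b1 u1 v'1 u'1 v1]] := interior_stuck uI vI zu zv Fuv' Fu'v.
have [||//||//|S2 [b2 u2 v2 u'2 v'2]] := st uX u'X v'Y vY zu.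
- by rewrite z_sym.
- by rewrite (interior_out uI) // vX.
- apply/negP => hu'v'; have [_ _ /(_ _ _ hu'v')] := b1.
  by rewrite (negPf u'1) v'1 v'X u'Y andbF => /(_ isT).
by case: (barrier_twist k0 aX aY dXY b1 b2 uX u1 u2 u'X u'1 u'2 v'Y v'1 v'2 vY v1 v2).
Qed.

(** A smallest halving part has more than [delta] vertices, hence a vertex all of
    whose neighbours lie in the part, and no halving separates the part. *)
Lemma stuck_deficient : k.+1 < delta -> False.
Proof.
move=> k1; have [v vI] := interior_neq0 aY.
have [P hP mP] : exists2 P, halving X P & forall Q, halving X Q -> #|P| <= #|Q|.
  have [u uI] := interior_neq0 aX.
  have [u' zu Fu'] := nbh_fresh u v; have [v' zv Fv'] := nbh_fresh v u.
  have [|//|S [[hS _ _] _ _ _ _]] := interior_stuck uI vI zu zv.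
    by [].
    by rewrite F_sym.
  by case: (arg_minnP (fun P : {set V} => #|P|) hS) => P; exists P.
have /and3P[sPX /eqP cP _] := hP.
have [u uP] : exists u, u \in interior P.
  apply/set0Pn; apply: contraTneq (leq_boundary (subxx P)) => ->.
  rewrite setD0 -[ecount _ _]/(cut P) cP.
  have := @small_cut_card P (halving_neq0 hP); rewrite cP => /(_ k1).
  by move: k1; clear; lia.
have uI : u \in interior X.
  move: uP; rewrite !inE => /andP[uP sP]; rewrite (subsetP sPX) //=.
  exact: subset_trans sP sPX.
have [u' zu Fu'] := nbh_fresh u v; have [v' zv Fv'] := nbh_fresh v u.
have [|S [[hS _ _] uS _ u'S _]] := interior_stuck uI vI zu zv Fv'.
  by rewrite F_sym.
have u'P := interior_adj uP (z_h zu).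
have {}uP := subsetP (interior_sub P) _ uP.
have sep Q a b : halving X Q -> a \in P -> a \in Q -> b \in P -> b \notin Q ->
    P :|: Q = X.
  move=> hQ aP aQ bP bQ; apply/eqP; apply: contraT => UX.
  have := mP _ (halvingI aX hP hQ _ UX); rewrite leqNgt => /(_ _)/negP[].
    by apply/set0Pn; exists a; rewrite inE aP.
  apply: proper_card; rewrite properE subsetIl; apply/subsetPn; exists b => //.
  by rewrite inE (negPf bQ) andbF.
have uX := subsetP sPX _ uP; have u'X := subsetP sPX _ u'P.
have e1 : P :|: (X :&: S) = X.
  by apply: sep hS uP _ u'P _; rewrite inE ?uX ?u'X.
have e2 : P :|: X :\: (X :&: S) = X.
  by apply: sep (halvingD hS) u'P _ uP _; rewrite !inE ?uX ?u'X ?uS ?u'S.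
case/negP: (halving_neq hP); rewrite eqEsubset sPX; apply/subsetP => x xX.
move/setP/(_ x): e1; move/setP/(_ x): e2; rewrite !inE xX /=.
by case: (x \in P); case: (x \in S).
Qed.


(** Otherwise the exchange of [u w] with an edge at [v] is admissible, and its barrier
    separates [u] from [w]. *)
Lemma inseparable_F K u w v :
  K \subset X -> inseparable X K -> u \in K -> u \in interior X -> w \in K -> z u w ->
  v \in interior Y -> F v w.
Proof.
move=> sK iK uK uI wK zuw vI; apply: contraT => Fvw.
have [v' zv Fv'] := nbh_fresh v u.
have [|S [[hS _ _] uS _ wS _]] := interior_stuck uI vI zuw zv Fv'.
  by rewrite F_sym.
have := iK _ _ _ hS uK wK; rewrite !inE (subsetP sK _ uK) uS (negPf wS) andbF.
by move=> /(_ isT).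
Qed.

Lemma F_uniq x y1 y2 : f <= 1 -> F x y1 -> F x y2 -> y1 = y2.
Proof.
move=> f1 F1 F2; apply/eqP; apply: contraT => ny.
have : [set y1; y2] \subset nbh F x by rewrite subUset !sub1set !inE F1.
move/subset_leq_card; rewrite cards2 ny => c.
by have := leq_trans c (leq_trans (degF x) f1).
Qed.

(** Here [F] is a matching.  For interior [v] and [u] that are not [F]-adjacent,
    [stuck_F_edge] for all [z]-edges at [v] and [u] forces an [F]-edge from [v] to a
    [z]-neighbour of [u] and one from [u] to a [z]-neighbour of [v].  As [u] has at
    most one [F]-neighbour and [v1], [v2] are not [z]-adjacent, it is neither [v1]
    nor [v2].  So [v1] and [v2] share it as a [z]-neighbour; a further
    [z]-neighbour [w] of [v1] must be [F]-adjacent to the [F]-neighbour of [v2],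
    hence equal to [v2]. *)
Lemma stuck_matching v1 v2 :
  0 < k -> f <= 1 -> (forall x, 1 < #|nbh z x|) -> v1 != v2 ->
  v1 \in interior X -> v2 \in interior X -> ~~ z v1 v2 -> False.
Proof.
move=> k0 f1 z2 nv v1I v2I nz; have [u uI] := interior_neq0 aY.
have Fe v w y : v \in interior X -> z v w -> z u y -> [|| F v u, F v y, F w u | F w y].
  by move=> vI zv zu; apply: stuck_F_edge.
have other x w : exists2 y, z x y & y != w.
  have : ~~ (nbh z x \subset [set w]).
    by apply/negP => /subset_leq_card; rewrite cards1 leqNgt z2.
  by case/subsetPn => y; rewrite !inE; exists y.
have hitu v : v \in interior X -> ~~ F v u -> exists2 y, z u y & F v y.
  move=> vI Fvu; have [|no] := pickP [pred y in nbh z u | F v y].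
    by move=> y; rewrite !inE => /andP[]; exists y.
  have [w zw Fw] := nbh_fresh v u; rewrite F_sym in Fw.
  have [y0 zy0 _] := other u u; have [y1 zy1 ny] := other u y0.
  have Fwy y : z u y -> F w y.
    move=> zy; have := Fe _ _ _ vI zw zy; have := no y; rewrite !inE zy /= => ->.
    by rewrite (negPf Fvu) (negPf Fw).
  by case/eqP: ny; apply: F_uniq f1 (Fwy _ zy1) (Fwy _ zy0).
have hitv v : v \in interior X -> ~~ F v u -> exists2 w, z v w & F w u.
  move=> vI Fvu; have [|no] := pickP [pred w in nbh z v | F w u].
    by move=> w; rewrite !inE => /andP[]; exists w.
  have [y zy Fy] := nbh_fresh u v.
  have [w0 zw0 _] := other v v; have [w1 zw1 nw] := other v w0.
  have Fyw w : z v w -> F y w.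
    move=> zw; have := Fe _ _ _ vI zw zy; have := no w; rewrite !inE zw /= => ->.
    by rewrite (negPf Fvu) (negPf Fy) /= F_sym.
  by case/eqP: nw; apply: F_uniq f1 (Fyw _ zw1) (Fyw _ zw0).
have nF v v' : v \in interior X -> v' \in interior X -> v != v' -> ~~ z v v' ->
    ~~ F v u.
  move=> vI v'I nvv nzv; apply/negP => Fvu.
  have [|w zw Fw] := hitv v' v'I.
    apply/negP => Fv'u; case/eqP: nvv.
    by apply: (F_uniq (x := u) f1); rewrite F_sym.
  have ew : w = v by apply: (F_uniq (x := u) f1); rewrite F_sym.
  by case/negP: nzv; rewrite z_sym -ew.
have nF1 := nF _ _ v1I v2I nv nz.
have nF2 : ~~ F v2 u by apply: nF v1I _ _ => //; rewrite 1?eq_sym // z_sym.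
have [w1 zw1 Fw1] := hitv _ v1I nF1; have [w2 zw2 Fw2] := hitv _ v2I nF2.
have [y1 zy1 Fy1] := hitu _ v1I nF1; have [y2 zy2 Fy2] := hitu _ v2I nF2.
have [w zw nw] := other v1 w1.
have := Fe _ _ _ v1I zw zy2; rewrite (negPf nF1) /= => /or3P[F1|F2|F3].
- case/eqP: nv; have ey := F_uniq f1 F1 Fy1; rewrite F_sym ey in F1.
  by apply: (F_uniq f1 F1); rewrite F_sym -ey.
- by case/eqP: nw; apply: (F_uniq (x := u) f1); rewrite F_sym.
- case/negP: nz; suff <- : w = v2 by [].
  by apply: (F_uniq (x := y2) f1); rewrite F_sym.
Qed.

Lemma core_sub K : core X K -> K \subset X.
Proof.
by case=> [/and3P[] //|p _ _ _ s _]; apply: subset_trans s (interior_sub X).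
Qed.

End Pair.

(** * The case delta = k + 1 *)

Lemma sum_exits X K D : D \subset interior X ->
  \sum_(u in D) #|nbh z u :\: K| <= ecount D (X :\: K).
Proof.
move=> sD; rewrite ecount_nbh; apply: leq_sum => u uD; apply: subset_leq_card.
apply/subsetP => w; rewrite !inE => /andP[-> /z_h huw].
by rewrite huw (interior_adj (subsetP sD _ uD) huw).
Qed.

Lemma large_exits X K : atom X -> halving X K ->
  2 * \sum_(u in K :&: interior X) #|nbh z u :\: K| <= k + 2.
Proof.
move=> aX hK; have [_ <-] := halving_out aX hK; rewrite leq_mul2l /=.
apply: leq_trans (sum_exits _ (subsetIr _ _)) _.
by apply: leq_ecount => //; apply: subsetIl.
Qed.

(** Edges leaving [K] inside [X] end in [p] or outside [p |: K]; both kinds number at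
    most [k/2 + 1] because [{p}] and [p |: K] are halving parts. *)
Lemma pendant_exits X K p :
  atom X -> halving X [set p] -> halving X (p |: K) -> K \subset interior X ->
  p \notin K -> \sum_(u in K) #|nbh z u :\: K| <= k + 2.
Proof.
move=> aX hp hK sK pK; apply: leq_trans (sum_exits _ sK) _.
have [_ i1] := halving_out aX hp; have [_ i2] := halving_out aX hK.
rewrite (ecountIDr _ _ [set p]).
have l1 : ecount K ((X :\: K) :&: [set p]) <= ecount [set p] (X :\: [set p]).
  rewrite ecountC; apply: leq_ecount; first exact: subsetIr.
  apply/subsetP => x xK; rewrite !inE (subsetP (interior_sub X)) ?(subsetP sK) //.
  by rewrite andbT; apply: contraTneq xK => ->.
have l2 : ecount K ((X :\: K) :\: [set p]) <= ecount (p |: K) (X :\: (p |: K)).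
  by apply: leq_ecount; [apply: subsetUr | rewrite setDDl setUC].
by move: i1 i2 l1 l2; clear; lia.
Qed.

Lemma large_interior X K : atom X -> halving X K -> k < #|K| ->
  k + 2 <= 2 * #|K :&: interior X|.
Proof.
move=> aX hK Kk; have := halving_boundary aX hK; have := cardsID (interior X) K.
by move: Kk; clear; lia.
Qed.

Section Regular.

Hypotheses (k_gt0 : 0 < k) (f_gt0 : 0 < f) (delta_k : delta = k.+1).

(** Without inner edges, each interior vertex of [K] sends at least [f + 1 >= 2]
    edges out of [K], too many unless [k = 2], [f = 1] and [K] consists of two
    vertices, which are not [z]-adjacent. *)
Lemma inner_edge X Y K :
  atom X -> atom Y -> [disjoint X & Y] -> stuck X Y -> core X K ->
  exists u w, [/\ u \in K :&: interior X, w \in K & z u w].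
Proof.
move=> aX aY dXY st cK.
have [[u w] /and3P[uI wK zuw]|no] :=
  pickP [pred e | [&& e.1 \in K :&: interior X, e.2 \in K & z e.1 e.2]].
  by exists u, w.
have out u : u \in K :&: interior X -> f < #|nbh z u :\: K|.
  move=> uK; suff -> : nbh z u :\: K = nbh z u by [].
  apply/setDidPl; rewrite disjoints_subset; apply/subsetP => w zuw.
  rewrite inE; apply/negP => wK; have := no (u, w).
  by rewrite /= uK wK; move: zuw; rewrite inE => ->.
have sum D : D \subset K :&: interior X ->
    f.+1 * #|D| <= \sum_(u in D) #|nbh z u :\: K|.
  move=> sD; rewrite mulnC -sum_nat_const; apply: leq_sum => u uD.
  by apply: out; apply: (subsetP sD).
exfalso; case: cK sum no out => [hK Kk|p hp hpK pK sK Kk] sum no out.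
  have := sum _ (subxx _); have := large_exits aX hK.
  have := large_interior aX hK Kk; move: k_gt0 f_gt0; clear; nia.
have eK : K :&: interior X = K by apply/setIidPl.
rewrite eK in no out sum.
have [f1 kK] : f = 1 /\ #|K| = 2.
  have := sum _ (subxx _); have := pendant_exits aX hp hpK sK pK.
  have [hh _] := halving_out aX hp; move: hh.
  move: k_gt0 f_gt0 Kk; clear; nia.
have /card_gt1P[a [b [aK bK nab]]] : 1 < #|K| by rewrite kK.
apply: (stuck_matching aX aY dXY st k_gt0 _ _ nab).
- by rewrite f1.
- by move=> x; rewrite -f1.
- exact: (subsetP sK).
- exact: (subsetP sK).
by have := no (a, b); rewrite /= aK bK /= => ->.
Qed.

Lemma card_interior_le X Y K :
  atom X -> atom Y -> [disjoint X & Y] -> stuck X Y -> core X K ->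
  inseparable X K -> #|interior Y| <= f.
Proof.
move=> aX aY dXY st cK iK.
have [u [w [/setIP[uK uI] wK zuw]]] := inner_edge aX aY dXY st cK.
apply: leq_trans (degF w); apply: subset_leq_card; apply/subsetP => v vI.
rewrite inE F_sym.
exact: (inseparable_F dXY st (core_sub cK) iK uK uI wK zuw vI).
Qed.

(** Let [D] be the set of interior vertices of [K].  All their
    [z]-neighbours in [K] are [F]-neighbours of one interior vertex [v] of [Y], at most [f] vertices.  So every vertex of [D] has a [z]-edge
    out of [K], and a vertex of [D] that is itself an [F]-neighbour of [v] has two.
    If there is no such vertex, the [z]-neighbours in [K] are not interior, at most
    [k/2 < f] vertices, and every vertex of [D] has two edges out of [K].  Either way
    there are more than the [k/2 + 1 <= #|D|] edges available. *)
Lemma large_absurd X Y K :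
  atom X -> atom Y -> [disjoint X & Y] -> stuck X Y -> halving X K -> k < #|K| ->
  inseparable X K -> #|interior X| <= f -> False.
Proof.
move=> aX aY dXY st hK Kk iK If.
have [v vI] := interior_neq0 aY.
have /and3P[sKX _ _] := hK.
set D := K :&: interior X.
have D2 : k + 2 <= 2 * #|D| by apply: large_interior.
have Df : #|D| <= f.
  by apply: leq_trans If; apply: subset_leq_card; apply: subsetIr.
have inF u : u \in D -> nbh z u :&: K \subset nbh F v.
  case/setIP=> uK uI; apply/subsetP => w; rewrite !inE => /andP[zuw wK].
  exact: (inseparable_F dXY st sKX iK uK uI wK zuw vI).
have split u : f < #|nbh z u :&: K| + #|nbh z u :\: K| by rewrite cardsID.
have out1 u : u \in D -> 0 < #|nbh z u :\: K|.
  move=> uD; have := split u; have := leq_trans (subset_leq_card (inF u uD)) (degF v).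
  by clear; lia.
have ge1 : \sum_(u in D) 1 <= \sum_(u in D) #|nbh z u :\: K|.
  by apply: leq_sum => u; apply: out1.
have := large_exits aX hK; rewrite -/D.
have [u /andP[uD Fvu]|noF] := pickP [pred u in D | F v u].
  have out2 : 1 < #|nbh z u :\: K|.
    have : nbh z u :&: K \proper nbh F v.
      rewrite properE inF //; apply/subsetPn; exists u; rewrite !inE //.
      by apply/negP => /andP[/z_h]; rewrite h_irr.
    move/proper_card; move: (split u) (degF v); clear; lia.
  have := out2; move: D2; rewrite (bigD1 u) //= (cardsD1 u) uD.
  have : \sum_(w in D | w != u) 1 <= \sum_(w in D | w != u) #|nbh z w :\: K|.
    by apply: leq_sum => w /andP[wD _]; apply: out1.
  have -> : \sum_(w in D | w != u) 1 = #|D :\ u|.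
    by rewrite sum1dep_card; apply: eq_card => w; rewrite !inE andbC.
  by clear; lia.
have ge2 : \sum_(u in D) 2 <= \sum_(u in D) #|nbh z u :\: K|.
  apply: leq_sum => u uD.
  have : nbh z u :&: K \subset K :\: interior X.
    apply/subsetP => w wzK; have wK := subsetP (subsetIr _ _) _ wzK.
    rewrite inE wK andbT; apply/negP => wI.
    have := noF w; rewrite /= /D in_setI wK wI /= => nFw.
    by have := subsetP (inF u uD) _ wzK; rewrite inE nFw.
  move/subset_leq_card; have := halving_boundary aX hK; move: (split u) Df D2.
  by clear; lia.
move: ge2; rewrite sum_nat_const; move: D2 k_gt0; clear; lia.
Qed.

(** The bounds [k <= #|K| <= #|interior X| <= f < delta] collapse, so [K] is the
    interior, of size [k = f].  A vertex of [K] has less than [k] neighbours in [K],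
    hence two [z]-edges out of [K], and [2 k <= k + 2].  With the counts tight, each
    vertex of [K] has a [z]-neighbour in [K], so [K] fills the [F]-neighbourhood of
    any interior vertex of [Y]. *)
Lemma pendant_tight X Y K p :
  atom X -> atom Y -> [disjoint X & Y] -> stuck X Y ->
  halving X [set p] -> halving X (p |: K) -> p \notin K -> K \subset interior X ->
  k <= #|K| -> inseparable X K -> #|interior X| <= f ->
  [/\ k = 2, forall a, a \in interior X -> 1 < #|nbh z a :\: interior X| &
      forall v x, v \in interior Y -> x \notin interior X -> ~~ F v x].
Proof.
move=> aX aY dXY st hp hpK pK sK Kk iK If.
have sKI := subset_leq_card sK.
have [fk cK] : f = k /\ #|K| = k.
  by move: f_delta sKI If Kk; rewrite delta_k; clear; lia.
have eK : K = interior X by apply/eqP; rewrite eqEcard sK cK -fk.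
have inner u : u \in K -> #|nbh z u :&: K| < k.
  move=> uK; rewrite -cK; apply: proper_card; rewrite properE subsetIr.
  apply/subsetPn; exists u => //; rewrite !inE; apply/negP => /andP[/z_h].
  by rewrite h_irr.
have split u : f < #|nbh z u :&: K| + #|nbh z u :\: K| by rewrite cardsID.
have out2 u : u \in K -> 1 < #|nbh z u :\: K|.
  by move=> /inner; move: (split u); rewrite fk; clear; lia.
have total := pendant_exits aX hp hpK sK pK.
have k2 : k = 2.
  have : \sum_(u in K) 2 <= \sum_(u in K) #|nbh z u :\: K| by apply: leq_sum.
  rewrite sum_nat_const cK; have [hh _] := halving_out aX hp.
  by move: hh total k_gt0; clear; lia.
split=> // [a aI|v x vI xI]; first by rewrite -eK out2 ?eK.
have sF : K \subset nbh F v.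
  apply/subsetP => w wK; have [u] : exists u, u \in nbh z w :&: K.
    apply/set0Pn; rewrite -card_gt0; have := split w.
    have : \sum_(y in K | y != w) 2 <= \sum_(y in K | y != w) #|nbh z y :\: K|.
      by apply: leq_sum => y /andP[yK _]; apply: out2.
    rewrite sum_nat_const; have -> : #|[pred y in K | y != w]| = #|K :\ w|.
      by apply: eq_card => y; rewrite !inE andbC.
    move: total cK; rewrite (bigD1 w) //= (cardsD1 w K) wK fk k2; clear; lia.
  rewrite !inE => /andP[zwu uK].
  apply: (inseparable_F dXY st _ iK uK _ wK _ vI).
  - exact: subset_trans sK (interior_sub X).
  - exact: (subsetP sK).
  by rewrite z_sym.
apply: contra xI => Fvx; rewrite -eK.
have -> : K = nbh F v by apply/eqP; rewrite eqEcard sF cK -fk degF.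
by rewrite inE.
Qed.

Lemma core_tight X Y K :
  atom X -> atom Y -> [disjoint X & Y] -> stuck X Y -> core X K -> inseparable X K ->
  #|interior X| <= f ->
  [/\ k = 2, forall a, a \in interior X -> 1 < #|nbh z a :\: interior X| &
      forall v x, v \in interior Y -> x \notin interior X -> ~~ F v x].
Proof.
move=> aX aY dXY st [hK Kk|p hp hpK pK sK Kk] iK If.
  by case: (large_absurd aX aY dXY st hK Kk iK If).
exact: pendant_tight hp hpK pK sK Kk iK If.
Qed.

(** In the remaining case, an edge from an interior vertex [a] to a boundary vertex
    [p] of [X] may be exchanged with the edges from [a'] to two boundary vertices
    [q1], [q2] of [Y].  A halving part of [Y] contains at most [k/2 = 1] boundary
    vertex, so the two barriers separate [q1] from [q2] in opposite ways. *)
Lemma stuck_regular X Y :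
  atom X -> atom Y -> [disjoint X & Y] -> stuck X Y -> False.
Proof.
move=> aX aY dXY st.
have dYX : [disjoint Y & X] by rewrite disjoint_sym.
have st' := stuck_sym st.
have [a aI] := interior_neq0 aX; have [a' a'I] := interior_neq0 aY.
have [PX [PY [hPX hPY]]] : exists PX PY, halving X PX /\ halving Y PY.
  have [u zu Fu] := nbh_fresh a a'; have [v zv Fv] := nbh_fresh a' a.
  rewrite F_sym in Fu.
  have [S [[bl br _] _ _ _ _]] := interior_stuck dXY st aI a'I zu zv Fv Fu.
  by exists (X :&: S), (Y :&: S).
have [K cK iK] := core_exists k_gt0 delta_k aX hPX.
have [L cL iL] := core_exists k_gt0 delta_k aY hPY.
have IX := card_interior_le aY aX dYX st' cL iL.
have IY := card_interior_le aX aY dXY st cK iK.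
have [k2 exX FX] := core_tight aX aY dXY st cK iK IX.
have [_ exY FY] := core_tight aY aX dYX st' cL iL IY.
have [p pN] : exists p, p \in nbh z a :\: interior X.
  by apply/set0Pn; rewrite -card_gt0 (leq_trans _ (exX _ aI)).
have /card_gt1P[q1 [q2 [q1N q2N nq]]] := exY _ a'I.
have nD x y A : y \in nbh z x :\: A -> y \notin A /\ z x y.
  by rewrite in_setD inE => /andP[].
have [pI zp] := nD _ _ _ pN.
have [[q1I zq1] [q2I zq2]] := (nD _ _ _ q1N, nD _ _ _ q2N).
have Fp : ~~ F p a' by rewrite F_sym FX.
have Fq q : q \notin interior Y -> ~~ F a q by apply: FY.
have [S1 [b1 a1 q11 p1 a'1]] := interior_stuck dXY st aI a'I zp zq1 (Fq _ q1I) Fp.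
have [S2 [b2 a2 q22 p2 a'2]] := interior_stuck dXY st aI a'I zp zq2 (Fq _ q2I) Fp.
have q1Y := interior_adj a'I (z_h zq1); have q2Y := interior_adj a'I (z_h zq2).
have excl S : barrier X Y S -> q1 \in S -> q2 \in S -> False.
  case=> _ hS _ q1S q2S; have := halving_boundary aY hS.
  have : [set q1; q2] \subset (Y :&: S) :\: interior Y.
    by rewrite subUset !sub1set !in_setD !in_setI q1I q2I q1Y q2Y q1S q2S.
  by move/subset_leq_card; rewrite cards2 nq k2; clear; lia.
have q12 : q1 \notin S2 by apply/negP => q12; apply: excl b2 q12 q22.
have q21 : q2 \notin S1 by apply/negP => q21; apply: excl b1 q11 q21.
have aiX := subsetP (interior_sub X) _ aI; have pX := interior_adj aI (z_h zp).
exact: (barrier_twist k_gt0 aX aY dXY b1 b2 aiX a1 a2 pX p1 p2 q1Y q11 q12 q2Y q21 q22).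
Qed.

End Regular.

Lemma stuck_absurd X Y :
  1 < delta -> atom X -> atom Y -> [disjoint X & Y] -> stuck X Y -> False.
Proof.
move=> d1 aX aY dXY st; have [kd|] := ltnP k.+1 delta.
  exact: stuck_deficient aX aY dXY st kd.
move=> dk; have {dk} dk : delta = k.+1 by apply/eqP; rewrite eqn_leq dk.
have k0 : 0 < k by rewrite -ltnS -dk.
have [f0|f0] := posnP f; last exact: stuck_regular k0 f0 dk X Y aX aY dXY st.
have noF x y : F x y = false.
  apply: contraTF (degF x) => Fxy; rewrite f0 -ltnNge card_gt0.
  by apply/set0Pn; exists y; rewrite inE.
have [u uI] := interior_neq0 aX; have [v vI] := interior_neq0 aY.
have [u' zu _] := nbh_fresh u u; have [v' zv _] := nbh_fresh v v.
by have := stuck_F_edge aX aY dXY st k0 uI vI zu zv; rewrite !noF.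
Qed.

(** * Exchanges that destroy a tight cut *)

Definition improving u u' v v' : bool :=
  [&& z u u', z v v', ~~ h u v', ~~ F u v', ~~ h u' v, ~~ F u' v,
    [exists T : {set V}, [&& tight T, u \in T, u' \in T, v \notin T & v' \notin T]] &
    [forall S : {set V}, [&& u \in S, v' \in S, u' \notin S & v \notin S] ==>
       (k + 2 < cut S)]].

Lemma improving_or_stuck X Y :
  atom X -> atom Y -> [disjoint X & Y] ->
  (forall u u' v v', ~~ improving u u' v v') -> stuck X Y.
Proof.
move=> aX aY dXY no u u' v v' uX u'X vY v'Y zu zv huv' Fuv' hu'v Fu'v.
have := no u u' v v'; rewrite /improving zu zv huv' Fuv' hu'v Fu'v /=.
rewrite negb_and => /orP[/existsPn/(_ X)|/forallPn[S]].
  by rewrite (atom_tight aX) uX u'X (disjointFl dXY vY) (disjointFl dXY v'Y).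
rewrite negb_imply -leqNgt => /andP[/and4P[uS v'S u'S vS] cS].
exists S; split=> //; apply: cross_barrier => //; apply/set0Pn.
- by exists u; rewrite inE uX.
- by exists u'; rewrite inE u'X u'S.
- by exists v'; rewrite inE v'Y.
- by exists v; rewrite inE vY vS.
Qed.

Lemma improving_regular T :
  1 < delta -> tight T -> exists u u' v v', improving u u' v v'.
Proof.
move=> d1 tT.
have [[[[u u'] v] v'] imp|no] :=
    pickP [pred e : V * V * V * V | improving e.1.1.1 e.1.1.2 e.1.2 e.2].
  by exists u, u', v, v'.
have [X aX sX] := minset_exists tT; have [Y aY sY] := minset_exists (tightC tT).
have dXY : [disjoint X & Y].
  by rewrite disjoints_subset (subset_trans sX) // -(setCK T) setCS.
case: (stuck_absurd d1 aX aY dXY).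
by apply: improving_or_stuck => // u u' v v'; have /= -> := no (u, u', v, v').
Qed.

Lemma cut_gt1 S x y a b : h x y -> x \in S -> y \notin S -> h a b -> a \in S ->
  b \notin S -> (a, b) != (x, y) -> 1 < cut S.
Proof.
move=> hxy xS yS hab aS bS ne; rewrite /cut /ecount pair_bigA /=.
rewrite (bigD1 (x, y)) //= (bigD1 (a, b)) //= !inE xS aS yS bS hxy hab.
by clear; lia.
Qed.

(** A tight set [U] is closed under [h].  If [x y] lies in no cut of size one, a set
    [S] that separates it and an edge on the other side of [U] has at least two
    edges inside [U] and one outside. *)
Lemma improving_low T :
  delta = 1 -> tight T -> #|V| <= #|arcs z| + 1 ->
  exists u u' v v', improving u u' v v'.
Proof.
move=> d1 tT zV.
have k0 : k = 0 by move: k_delta; rewrite d1; clear; lia.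
have noF x y : F x y = false.
  apply: contraTF (leq_trans (degF x) (_ : f <= 0)) => [Fxy|].
    by rewrite -ltnNge card_gt0; apply/set0Pn; exists y; rewrite inE.
  by move: f_delta; rewrite d1; clear; lia.
have cT0 U : tight U -> cut U = 0 by rewrite -k0 => /and3P[_ _ /eqP].
have [x [y [zxy xyS]]] : exists x y, z x y /\
    forall S, x \in S -> y \notin S -> 1 < cut S.
  pose nb e := [forall S : {set V}, (e.1 \in S) && (e.2 \notin S) ==> (1 < cut S)].
  have [[x y] /andP[zxy /forallP xyS]|no] := pickP [pred e | z e.1 e.2 && nb e].
    exists x, y; split=> // S xS yS.
    by have := implyP (xyS S); rewrite /= xS yS; apply.
  have [T0 TT _] := and3P tT.
  have : #|arcs z| + 2 <= #|V|.
    apply: (card_forest z_sym T0 TT).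
    - by move=> x y /z_h; apply: cut_eq0; apply: cT0.
    move=> x y zxy; have := no (x, y); rewrite /= zxy => /negbT/forallPn[S].
    rewrite negb_imply -leqNgt /= => /andP[/andP[xS yS] cS].
    exists S; split=> // a b zab aS bS; apply/eqP; apply: contraLR cS => ne.
    by rewrite -ltnNge; apply: cut_gt1 ne => //; apply: z_h.
  by move: zV; clear; lia.
have [U tU xU] : exists2 U, tight U & x \in U.
  have [xT|xT] := boolP (x \in T); first by exists T.
  by exists (~: T); [apply: tightC | rewrite inE].
have yU : y \in U by rewrite -(cut_eq0 (cT0 _ tU) (z_h zxy)).
have [v vU] : exists v, v \notin U.
  have /and3P[_ UT _] := tU; have : ~~ (setT \subset U) by rewrite subTset.
  by case/subsetPn => v _; exists v.
have [v' zv _] := nbh_fresh v v.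
have v'U : v' \notin U by rewrite -(cut_eq0 (cT0 _ tU) (z_h zv)).
have sepU a b : a \in U -> b \notin U -> ~~ h a b.
  by move=> aU bU; apply/negP => /(cut_eq0 (cT0 _ tU)); rewrite aU (negPf bU).
exists x, y, v, v'; rewrite /improving zxy zv !noF !sepU //=.
apply/andP; split; first by apply/existsP; exists U; rewrite tU xU yU vU.
apply/forallP => S; apply/implyP => /and4P[xS v'S yS vS].
have := cut_modular U S; rewrite (cT0 _ tU).
have : 1 < cut (U :&: S) by apply: xyS; rewrite inE ?xU // negb_and yS orbT.
have : 0 < cut (U :|: S).
  apply: (@cut_gt0 _ v' v); rewrite ?inE ?v'S ?orbT ?negb_or ?vU //.
  by rewrite h_sym z_h.
by rewrite k0; clear; lia.
Qed.

End Stuck.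
End Tight.
End Cuts.
(** * Edge connectivity and minimum degree as minima over cuts *)

Section BigMin.

Variables (I : finType) (P : pred I) (F : I -> nat) (n : nat).

Lemma leq_bigminn m :
  m <= n -> (forall i, P i -> m <= F i) -> m <= \big[minn/n]_(i | P i) F i.
Proof.
by move=> mn mF; elim/big_ind: _ => // a b ma mb; rewrite leq_min ma.
Qed.

Lemma bigminn_leq i : P i -> \big[minn/n]_(j | P j) F j <= F i.
Proof.
move=> Pi; have: i \in index_enum I by apply: mem_index_enum.
elim: (index_enum I) => // j s IHs; rewrite in_cons big_cons => /predU1P[<-|/IHs le].
  by rewrite Pi geq_minl.
by case: ifP => // _; apply: leq_trans (geq_minr _ _) le.
Qed.

End BigMin.

Section GraphCuts.

Variable V : finType.
Implicit Types (G H : sgraph V) (T : {set V}) (M : {set {set V}}).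

Lemma set2_eq (a b c d : V) :
  [set a; b] = [set c; d] -> a = c /\ b = d \/ a = d /\ b = c.
Proof.
move=> e; have /set2P[ac|ad] : a \in [set c; d] by rewrite -e set21.
  left; split=> //; have /set2P[bc|//] : b \in [set c; d] by rewrite -e set22.
  have : d \in [set a; b] by rewrite e set22.
  by rewrite ac bc !inE orbb => /eqP ->.
right; split=> //; have /set2P[//|bd] : b \in [set c; d] by rewrite -e set22.
have : c \in [set a; b] by rewrite e set21.
by rewrite ad bd !inE orbb => /eqP ->.
Qed.

Lemma card_edges G : #|edges G| = #|arcs G|.
Proof.
suff -> : edges G = [set [set e.1; e.2] | e in arcs G].
  apply: card_in_imset => -[a b] [c d]; rewrite !inE /=.
  move=> /andP[_ ab] /andP[_ cd] /set2_eq[[-> -> //]|[ad bc]].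
  by move: cd; rewrite -ad -bc ltnNge ltnW.
apply/setP => S; apply/imsetP/imsetP => -[[a b]]; rewrite inE /= => Gab ->.
  case: (ltngtP (enum_rank a) (enum_rank b)) => r.
  - by exists (a, b); rewrite // inE /= Gab.
  - by exists (b, a); rewrite /= 1?setUC // inE /= adj_sym Gab.
  by have /enum_rank_inj eab := val_inj r; rewrite eab adj_irrefl in Gab.
by exists (a, b); rewrite // inE; case/andP: Gab.
Qed.

Lemma cut_leq_card G T M :
  (forall x y, G x y -> x \in T -> y \notin T -> [set x; y] \in M) ->
  cut G T <= #|M|.
Proof.
move=> cM; pose C := [set e : V * V | [&& e.1 \in T, e.2 \notin T & G e.1 e.2]].
have -> : cut G T = #|C|.
  rewrite /cut /ecount pair_bigA -sum1_card [RHS]big_mkcond.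
  by apply: eq_bigr => e _; rewrite !inE; case: and3P.
rewrite -(card_in_imset (f := fun e : V * V => [set e.1; e.2])).
  apply: subset_leq_card; apply/subsetP => _ /imsetP[e eC ->].
  by move: eC; rewrite inE => /and3P[? ? ?]; apply: cM.
move=> [a b] [c d]; rewrite !inE /= => /and3P[aT bT _] /and3P[cT dT _].
case/set2_eq=> [[-> -> //]|[ad bc]].
by rewrite ad (negPf dT) in aT.
Qed.

(** A disconnecting edge set contains the cut of a component of what remains, and the
    edges at [v] form a disconnecting set. *)
Lemma edge_connectivity_cuts H v :
  1 < #|V| -> (forall T, T != set0 -> T != setT -> deg H v <= cut H T) ->
  edge_connectivity H = deg H v.
Proof.
move=> V1 cutH.
have [w wv] : exists w, w != v.
  have : ~~ (setT \subset [set v]).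
    by apply/negP => /subset_leq_card; rewrite cards1 cardsT leqNgt V1.
  by case/subsetPn => w _; rewrite inE; exists w.
apply/eqP; rewrite eqn_leq; apply/andP; split; last first.
  apply: leq_bigminn => [|M /andP[sM]].
    apply: leq_trans (cutH [set v] _ _) (cut_leq_card _).
    - by apply/set0Pn; exists v; rewrite inE.
    - by apply/eqP => /setP/(_ w); rewrite !inE (negPf wv).
    by move=> x y Hxy _ _; rewrite in_edges.
  case/forallPn=> x /forallPn[y nxy].
  pose T := [set a | connect (del_edges H M) x a].
  apply: leq_trans (cutH T _ _) (cut_leq_card _).
  - by apply/set0Pn; exists x; rewrite inE connect0.
  - by apply/eqP => /setP/(_ y); rewrite !inE (negPf nxy).
  move=> a b Hab; rewrite !inE => xa nb; apply: contraT => abM; case/negP: nb.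
  by apply: connect_trans xa (connect1 _); rewrite /= /del_adj Hab.
pose M := [set [set v; y] | y in [set y | H v y]].
apply: leq_trans (_ : #|M| <= _); last exact: leq_imset_card.
apply: bigminn_leq; apply/andP; split.
  by apply/subsetP => _ /imsetP[y + ->]; rewrite inE in_edges.
apply/forallPn; exists v; apply/forallPn; exists w.
apply/negP => /connectP[[_ wv'|y p /= /andP[+ _] _]].
  by rewrite wv' eqxx in wv.
rewrite /del_adj => /andP[Hvy /negP]; apply; apply/imsetP; exists y => //.
by rewrite inE.
Qed.

Lemma min_deg_leq G v : min_deg G <= deg G v.
Proof. exact: bigminn_leq. Qed.

Lemma min_deg_attained G (v0 : V) : exists v, deg G v = min_deg G.
Proof.
have [v _ mv] := @arg_minnP V v0 predT (deg G) isT.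
exists v; apply/eqP; rewrite eqn_leq min_deg_leq andbT.
by apply: leq_bigminn => [|w _]; [apply: max_card | apply: mv].
Qed.

Lemma deg_leq_max G v : deg G v <= max_deg G.
Proof. exact: leq_bigmax. Qed.

End GraphCuts.

(** * Exchanging two edges *)

Section Switch.

Variable V : finType.
Implicit Types (g h : rel V) (x y a b : V) (A B S T : {set V}).

Definition link a b : rel V := fun x y => (x == a) && (y == b) || (x == b) && (y == a).

Lemma link_sym a b : symmetric (link a b).
Proof. by move=> x y; rewrite /link orbC ![(y == _) && _]andbC. Qed.

Definition switch g u u' v v' : rel V := fun x y =>
  [|| g x y && ~~ link u u' x y && ~~ link v v' x y, link u v' x y | link u' v x y].

Lemma switch_sym g u u' v v' : symmetric g -> symmetric (switch g u u' v v').
Proof. by move=> gs x y; rewrite /switch gs ![link _ _ x y]link_sym. Qed.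

Lemma switch_irrefl g u u' v v' :
  irreflexive g -> u != v' -> u' != v -> irreflexive (switch g u u' v v').
Proof.
move=> gi n1 n2 x; rewrite /switch gi /= /link.
apply/negP => /orP[]/orP[]/andP[/eqP e1 /eqP e2]; move: n1 n2;
  by rewrite -e1 -e2 eqxx // andbF.
Qed.

Lemma ecount_link a b A B : a != b ->
  ecount (link a b) A B = ((a \in A) && (b \in B)) + ((b \in A) && (a \in B)).
Proof.
have one c d : ecount (fun x y => (x == c) && (y == d)) A B = (c \in A) && (d \in B).
  rewrite /ecount (bigD1 c) //= [X in _ + X]big1 => [|x /negPf xc].
    rewrite addn0 (bigD1 d) //= [X in _ + X]big1 => [|y /negPf yd].
      by rewrite !eqxx addn0 !andbT.
    by rewrite yd !andbF.
  by apply: big1 => y _; rewrite xc !andbF.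
move=> nab; rewrite -!one /ecount -big_split; apply: eq_bigr => x _.
rewrite -big_split; apply: eq_bigr => y _ /=; rewrite /link.
have [->|_] := eqVneq x a; last by rewrite !andbF.
by rewrite (negPf nab) /= orbF !andbF addn0.
Qed.

Lemma link_disjoint a b c d x y :
  uniq [:: a; b; c; d] -> ~~ (link a b x y && link c d x y).
Proof.
rewrite /= !inE !negb_or andbT => /and3P[/and3P[_ ac ad] /andP[bc bd] _].
apply/negP => /andP[lab lcd].
have xab : x = a \/ x = b by case/orP: lab => /andP[/eqP]; auto.
have xcd : x = c \/ x = d by case/orP: lcd => /andP[/eqP]; auto.
by case: xab xcd ac ad bc bd => -> [] ->; rewrite eqxx.
Qed.

(** Stated without subtraction, so that degrees and cuts follow by summation. *)
Lemma switchE g u u' v v' :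
  symmetric g -> uniq [:: u; u'; v; v'] ->
  g u u' -> g v v' -> ~~ g u v' -> ~~ g u' v ->
  forall x y, switch g u u' v v' x y + link u u' x y + link v v' x y =
              g x y + link u v' x y + link u' v x y.
Proof.
move=> gs un g1 g2 g3 g4 x y.
have gl c d : link c d x y ==> (g x y == g c d).
  by apply/implyP; case/orP => /andP[/eqP -> /eqP ->] //; rewrite gs.
move: (gl u u') (gl v v') (gl u v') (gl u' v).
rewrite g1 g2 (negPf g3) (negPf g4) /switch.
have un' : uniq [:: u; v'; u'; v].
  rewrite (perm_uniq (s2 := [:: u; u'; v; v'])) // perm_cons.
  by rewrite (perm_catC [:: v'] [:: u'; v]).
have := link_disjoint x y un; have := link_disjoint x y un'.
by case: (g x y); case: (link u u' x y); case: (link v v' x y);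
  case: (link u v' x y); case: (link u' v x y).
Qed.

Section Counts.

Variables (g g' : rel V) (u u' v v' : V).
Hypothesis un : uniq [:: u; u'; v; v'].
Hypothesis g'E : forall x y, g' x y + link u u' x y + link v v' x y =
                             g x y + link u v' x y + link u' v x y.

Let nuu' : u != u'.
Proof. by move: un; rewrite /= !inE !negb_or => /andP[/and3P[]]. Qed.
Let nvv' : v != v'.
Proof. by move: un; rewrite /= !inE !negb_or => /and4P[_ _]. Qed.
Let nuv' : u != v'.
Proof. by move: un; rewrite /= !inE !negb_or => /andP[/and3P[]]. Qed.
Let nu'v : u' != v.
Proof. by move: un; rewrite /= !inE !negb_or => /and3P[_ /andP[]]. Qed.

Lemma ecount_switch A B :
  ecount g' A B + ecount (link u u') A B + ecount (link v v') A B =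
  ecount g A B + ecount (link u v') A B + ecount (link u' v) A B.
Proof.
rewrite /ecount -!big_split; apply: eq_bigr => x _.
rewrite -!big_split; apply: eq_bigr => y _ /=.
by case: (x \in A); case: (y \in B); rewrite //= g'E.
Qed.

Lemma nbh_switch x : #|nbh g' x| = #|nbh g x|.
Proof.
have := ecount_switch [set x] setT; rewrite !ecount_link // !ecount1 !setIT.
rewrite !inE !andbT ![_ == x]eq_sym; clear; lia.
Qed.

Lemma cut_switch T :
  cut g' T + ((u \in T) (+) (u' \in T)) + ((v \in T) (+) (v' \in T)) =
  cut g T + ((u \in T) (+) (v' \in T)) + ((u' \in T) (+) (v \in T)).
Proof.
have := ecount_switch T (~: T); rewrite !ecount_link // !inE.
rewrite -/(cut g T) -/(cut g' T).
by case: (u \in T); case: (u' \in T); case: (v \in T); case: (v' \in T);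
  rewrite ?addn0 ?addn1.
Qed.

Hypothesis g_sym : symmetric g.

(** A cut that loses edges loses two, and it is the cut of a set covered by the
    hypothesis or of the complement of one. *)
Lemma cut_switch_or k T :
  (forall S, u \in S -> v' \in S -> u' \notin S -> v \notin S -> k + 2 < cut g S) ->
  cut g T <= cut g' T \/ k < cut g' T.
Proof.
move=> big; have := cut_switch T; have := big T; have := big (~: T).
rewrite cutC // !inE.
case: (u \in T); case: (u' \in T); case: (v \in T); case: (v' \in T) => //= b1 b2 e;
  try (by left; move: e; clear; lia); right.
  by move: (b2 isT isT isT isT) e; clear; lia.
by move: (b1 isT isT isT isT) e; clear; lia.
Qed.

End Counts.
End Switch.

(** * Realizations *)

Section Realizations.

Variables (V : finType) (G0 F Z0 : sgraph V).
Hypotheses (hF : spanning_subgraph F G0) (hZ0 : spanning_subgraph Z0 G0).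
Hypothesis hFZ0 : edge_disjoint F Z0.
Hypothesis hdeg : max_deg F < min_deg Z0.
Implicit Types (G : sgraph V) (x y : V) (S T : {set V}).

Definition realization G : Prop :=
  (forall x, deg G x = deg G0 x) /\ (forall x y, G0 x y -> ~~ Z0 x y -> G x y).

Definition rest G : sgraph V := del_edges G (edges F).

Definition movable G : rel V := fun x y => G x y && ~~ (G0 x y && ~~ Z0 x y).

Lemma restE G x y : rest G x y = G x y && ~~ F x y.
Proof. by rewrite /= /del_adj in_edges. Qed.

Lemma sub_adj H G x y : spanning_subgraph H G -> H x y -> G x y.
Proof. by move/subsetP=> s; rewrite -!in_edges => /s. Qed.

Lemma F_fixed x y : F x y -> G0 x y /\ ~~ Z0 x y.
Proof.
move=> Fxy; split; first exact: sub_adj hF Fxy.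
by rewrite -in_edges; apply: (contraL _ Fxy) => Zxy;
  rewrite -in_edges (disjointFl hFZ0 Zxy).
Qed.

Lemma realization_F G x y : realization G -> F x y -> G x y.
Proof. by move=> [_ rG] /F_fixed[]; apply: rG. Qed.

Lemma movable_sym G : symmetric (movable G).
Proof. by move=> x y; rewrite /movable !(adj_sym _ y x). Qed.

Lemma movable_rest G : subrel (movable G) (rest G).
Proof.
move=> x y /andP[Gxy nf]; rewrite restE Gxy; apply: contra nf => Fxy.
by have [-> ->] := F_fixed Fxy.
Qed.

Lemma card_nbh_rest G x : realization G -> #|nbh (rest G) x| = deg G0 x - deg F x.
Proof.
move=> rG; have [<- _] := rG.
have -> : nbh (rest G) x = [set w | G x w] :\: [set w | F x w].
  by apply/setP => w; rewrite !in_set restE andbC.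
rewrite cardsD; congr (_ - _); apply: eq_card => w; rewrite !inE.
by case Fxw: (F x w); rewrite ?andbF // (realization_F rG Fxw).
Qed.

Lemma card_nbh_movable G x : realization G -> #|nbh (movable G) x| = deg Z0 x.
Proof.
move=> [dG rG]; pose A := [set w | G0 x w && ~~ Z0 x w].
have -> : nbh (movable G) x = [set w | G x w] :\: A.
  by apply/setP => w; rewrite !inE andbC.
have sAG : A \subset [set w | G x w].
  by apply/subsetP => w; rewrite !inE => /andP[]; apply: rG.
have eA : A = [set w | G0 x w] :\: [set w | Z0 x w].
  by apply/setP => w; rewrite !inE andbC.
have sZ : [set w | Z0 x w] \subset [set w | G0 x w].
  by apply/subsetP => w; rewrite !inE; apply: sub_adj.
rewrite cardsD (setIidPr sAG) -/(deg G x) dG eA cardsD (setIidPr sZ).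
by rewrite subKn // subset_leq_card.
Qed.

Lemma card_arcs_movable G : realization G -> #|arcs (movable G)| = #|edges Z0|.
Proof.
move=> rG; apply/eqP; rewrite card_edges -(eqn_pmul2l (isT : 0 < 2)).
rewrite -!sum_nbh; last 4 first.
- exact: adj_sym.
- exact: adj_irrefl.
- exact: movable_sym.
- by move=> x; rewrite /movable adj_irrefl.
by apply/eqP/eq_bigr => x _; rewrite card_nbh_movable.
Qed.

(** The set [T] that separates the two exchanged edges gains two edges and is no
    longer tight. *)
Lemma improve G k u u' v v' :
  realization G -> (forall T, T != set0 -> T != setT -> k <= cut (rest G) T) ->
  improving (rest G) k (movable G) F u u' v v' ->
  exists2 G', realization G' &
    (forall T, T != set0 -> T != setT -> k <= cut (rest G') T) /\
    [set T | tight (rest G') k T] \proper [set T | tight (rest G) k T].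
Proof.
move=> rG cG /and5P[zu zv huv' Fuv' /and4P[hu'v Fu'v]].
case/existsP=> T /and5P[tT uT u'T vT v'T].
move/forallP=> big.
have [Gu nu] := andP zu; have [Gv nv] := andP zv.
have ne a b : a \in T -> b \notin T -> a != b.
  by move=> aT; apply: contraNneq => <-.
have un : uniq [:: u; u'; v; v'].
  rewrite /= !inE !negb_or (ne u v) // (ne u v') // (ne u' v) // (ne u' v') //.
  rewrite !andbT; apply/andP; split.
    by apply: contraTneq Gu => ->; rewrite adj_irrefl.
  by apply: contraTneq Gv => ->; rewrite adj_irrefl.
have nG a b : ~~ rest G a b -> ~~ F a b -> ~~ G a b.
  by rewrite restE => + Fab; rewrite Fab andbT.
pose G' := SGraph (switch_sym u u' v v' (adj_sym G))
  (switch_irrefl (adj_irrefl G) (ne _ _ uT v'T) (ne _ _ u'T vT)).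
have GE := switchE (adj_sym G) un Gu Gv (nG _ _ huv' Fuv') (nG _ _ hu'v Fu'v).
have Fl a b x y : link a b x y -> F x y = F a b.
  by case/orP => /andP[/eqP -> /eqP ->] //; rewrite adj_sym.
have RE x y : rest G' x y + link u u' x y + link v v' x y =
              rest G x y + link u v' x y + link u' v x y.
  have -> : rest G' x y = switch (rest G) u u' v v' x y.
    rewrite restE /switch -/(switch G u u' v v') restE /= /switch.
    have := Fl u v' x y; have := Fl u' v x y; rewrite (negPf Fuv') (negPf Fu'v).
    case: (link u v' x y) => [_ /(_ isT) ->|+ _]; rewrite ?orbT //.
    by case: (link u' v x y) => [/(_ isT) ->|_]; rewrite ?orbT ?orbF //=;
      case: (F x y); rewrite ?andbF ?andbT.
  apply: switchE => //; by [apply: adj_sym | apply: movable_rest].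
have bigS S : u \in S -> v' \in S -> u' \notin S -> v \notin S -> k + 2 < cut (rest G) S.
  by move=> uS v'S u'S vS; have := implyP (big S); rewrite uS v'S u'S vS; apply.
have cut_or S := cut_switch_or un RE (adj_sym (rest G)) S bigS.
have cG' S : S != set0 -> S != setT -> k <= cut (rest G') S.
  move=> S0 ST; case: (cut_or S) => [le|/ltnW //].
  exact: leq_trans (cG S S0 ST) le.
exists G'; last split=> //.
  split=> [x|x y Gxy nZ]; first by rewrite -(proj1 rG) [LHS](nbh_switch un GE).
  have fl a b : movable G a b -> ~~ link a b x y.
    case/andP=> _ nf; apply/negP => /orP[]/andP[/eqP ex /eqP ey].
      by move: nf; rewrite -ex -ey Gxy nZ.
    by move: nf; rewrite -ex -ey !(adj_sym _ y x) Gxy nZ.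
  by rewrite /= /switch (proj2 rG _ _ Gxy nZ) !fl.
rewrite properE; apply/andP; split.
  apply/subsetP => S; rewrite !inE => /and3P[S0 ST /eqP cS].
  rewrite /tight S0 ST eqn_leq cG // andbT /=.
  by case: (cut_or S); rewrite cS // ltnn.
apply/subsetPn; exists T; rewrite inE //; apply/negP => /and3P[_ _ /eqP cT].
have := cut_switch un RE T; have /and3P[_ _ /eqP ->] := tT.
rewrite cT uT u'T (negPf vT) (negPf v'T) /=; clear; lia.
Qed.

Hypothesis hone : min_deg G0 = 1 -> #|V| - 1 <= #|edges Z0|.

Let delta := min_deg (rest G0).

Lemma realization_G0 : realization G0.
Proof. by []. Qed.

Lemma deg_rest G x : realization G -> deg (rest G) x = deg (rest G0) x.
Proof.
by move=> rG; rewrite [LHS](card_nbh_rest x rG) -(card_nbh_rest x realization_G0).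
Qed.

Lemma card_V_gt1 : 1 < #|V|.
Proof.
rewrite ltnNge; apply/negP => V1; have := hdeg; apply/negP; rewrite -leqNgt.
have [x _|noV] := pickP (@predT V); last by rewrite /min_deg big_pred0 ?eq_card0.
apply: leq_trans (min_deg_leq Z0 x) (leq_trans _ (leq0n _)).
apply: leq_trans (_ : #|[set~ x]| <= 0); last by rewrite cardsC1; case: #|V| V1 => [|[]].
apply: subset_leq_card; apply/subsetP => y; rewrite !inE.
by apply: contraTneq => ->; rewrite adj_irrefl.
Qed.

(** At a vertex of least degree, [f < deg z <= delta].  If [delta = 1], then [F] is
    empty and [G0] has minimum degree one, which is where [hone] applies. *)
Lemma improvable G k T :
  realization G -> k < delta ->
  (forall S, S != set0 -> S != setT -> k <= cut (rest G) S) -> tight (rest G) k T ->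
  exists u u' v v', improving (rest G) k (movable G) F u u' v v'.
Proof.
move=> rG kd cG tT.
have /set0Pn[x0 _] : T != set0 by case/and3P: tT.
have degF x : #|nbh F x| <= max_deg F := deg_leq_max F x.
have degz x : max_deg F < #|nbh (movable G) x|.
  by rewrite card_nbh_movable // (leq_trans hdeg) // min_deg_leq.
have degr x : delta <= #|nbh (rest G) x|.
  by rewrite -/(deg (rest G) x) deg_rest // min_deg_leq.
have [x dx] := min_deg_attained (rest G0) x0; rewrite -/delta in dx.
have zx : #|nbh (movable G) x| <= delta.
  rewrite -dx -(deg_rest x rG); apply: subset_leq_card; apply/subsetP => y.
  by rewrite !inE; apply: movable_rest.
have fd : max_deg F < delta := leq_trans (degz x) zx.
have [d1|d1] := ltnP 1 delta.
  exact: (improving_regular (adj_sym _) cG (@adj_irrefl _ _) degr kd (@movable_sym G)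
    (@adj_sym _ F) (@movable_rest G) degF degz fd d1 tT).
have {}d1 : delta = 1 by apply/eqP; rewrite eqn_leq d1 (leq_ltn_trans _ fd).
apply: (improving_low (adj_sym _) kd (@movable_sym G) (@movable_rest G)
  degF degz fd d1 tT).
rewrite card_arcs_movable //.
suff /hone : min_deg G0 = 1 by have := card_V_gt1; clear; lia.
apply/eqP; rewrite eqn_leq; apply/andP; split.
  apply: leq_trans (min_deg_leq G0 x) _; move: (degF x) fd dx.
  rewrite [deg (rest G0) x](card_nbh_rest x realization_G0) -/(deg F x) d1.
  by clear; lia.
apply: leq_bigminn => [|y _]; first exact: ltnW card_V_gt1.
rewrite -(proj1 rG); apply: leq_trans (leq_ltn_trans (leq0n _) (degz y)) _.
by apply: subset_leq_card; apply/subsetP => w; rewrite !inE => /andP[].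
Qed.

Lemma raise_cuts k G :
  k < delta -> realization G ->
  (forall T, T != set0 -> T != setT -> k <= cut (rest G) T) ->
  exists2 G', realization G' &
    forall T, T != set0 -> T != setT -> k < cut (rest G') T.
Proof.
move=> kd; have [n] := ubnP #|[set T | tight (rest G) k T]|.
elim: n G => // n IHn G le rG cG.
have [T tT|no] := pickP (tight (rest G) k); last first.
  exists G => // T T0 TT; rewrite ltn_neqAle cG // andbT eq_sym.
  by have := no T; rewrite /tight T0 TT /= => ->.
have [u [u' [v [v' imp]]]] := improvable rG kd cG tT.
have [G' rG' [cG' lt]] := improve rG cG imp.
by apply: IHn rG' cG'; apply: leq_trans (proper_card lt) _.
Qed.

Lemma realization_cuts k : k <= delta ->
  exists2 G, realization G &
    forall T, T != set0 -> T != setT -> k <= cut (rest G) T.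
Proof.
elim: k => [_|k IHk kd]; first by exists G0; [apply: realization_G0|].
by have [G rG cG] := IHk (ltnW kd); apply: raise_cuts kd rG cG.
Qed.

End Realizations.

Theorem theorem2 (V : finType) (G0 F Z0 : sgraph V)
    (hF : spanning_subgraph F G0) (hZ0 : spanning_subgraph Z0 G0)
    (hFZ0 : edge_disjoint F Z0)
    (hdeg : max_deg F < min_deg Z0)
    (hone : min_deg G0 = 1 -> #|V| - 1 <= #|edges Z0|) :
  exists G : sgraph V,
    [/\ forall v : V, deg G v = deg G0 v,
        edges G0 :\: edges Z0 \subset edges G
      & maximally_edge_connected (del_edges G (edges F))].
Proof.
have V1 := card_V_gt1 hdeg.
have [G rG cG] := realization_cuts hF hZ0 hFZ0 hdeg hone (leqnn _).
have /card_gt0P[x0 _] : 0 < #|V| by apply: ltnW.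
have [v dv] := min_deg_attained (rest F G0) x0.
exists G; split; first exact: (proj1 rG).
  apply/subsetP => e /setDP[/imsetP[[x y]]]; rewrite inE /= => Gxy ->.
  by rewrite !in_edges; apply: (proj2 rG).
have degG x : deg (rest F G) x = deg (rest F G0) x by apply: deg_rest rG.
have min_degG : min_deg (rest F G) = min_deg (rest F G0).
  by rewrite /min_deg (eq_bigr _ (fun x _ => degG x)).
rewrite /maximally_edge_connected -/(rest F G) min_degG -dv -degG.
by apply: edge_connectivity_cuts => // T T0 TT; rewrite degG dv; apply: cG.
Qed.
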